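(* Let $\mathcal{A}\subset M_n(\mathbb{F}_q)$ be an $\mathbb{F}_q$-subalgebra of dimension $m$ with $\mathbb{F}_q$-basis $a_1,\dots,a_m$, and let $\mathbb{G}$ be the multiplicative group of $\mathcal{A}$ as an algebraic group over $\mathbb{F}_q$. Let $\mathbf{t}=(t_1,\dots,t_m)$ be indeterminates, $A(\mathbf{t})=\sum_{i=1}^m t_ia_i$, $d=\det A(\mathbf{t})$, $R=\mathbb{F}_q[\mathbf{t},1/d]$ and $K=\mathbb{F}_q(\mathbf{t})$. Let $U\in\mathbb{G}(K_{\mathrm{sep}})$ satisfy $A=U(U^{(q)})^{-1}$, let $E=K(U)$ be the field generated over $K$ by the entries of $U$ (the splitting field of $AX^{(q)}=X$ over $K$), and let $S=R[U]$ be the subring of $E$ generated over $R$ by the entries of $U$. Then: (1) $\mathrm{Gal}(E/K)\cong\mathbb{G}(\mathbb{F}_q)=\mathcal{A}^\times$; (2) the ring extension $S/R$ is $\mathbb{G}(\mathbb{F}_q)$-generic over $\mathbb{F}_q$, where $\mathrm{Gal}(S/R)=\mathrm{Gal}(E/K)$ is identified with $\mathbb{G}(\mathbb{F}_q)$ via $\sigma\mapsto U^{-1}\sigma(U)$.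
   Context: For a commutative $\mathbb{F}_q$-algebra $L$, $\mathbb{G}(L)=(\mathcal{A}\otimes_{\mathbb{F}_q}L)^\times$, identified with the group of invertible matrices in the $L$-span of $\mathcal{A}$ inside $M_n(L)$; $K_{\mathrm{sep}}$ is a separable closure of $K$; $U^{(q)}$ is the entrywise $q$-th power of $U$ (such a $U$ exists by the Lang–Steinberg theorem). Definition: for a field $k$, a finite group $G$ and $R=k[\mathbf{t},1/d]$ with $d$ a nonzero polynomial, a Galois $G$-extension of commutative rings $S/R$ is $G$-generic over $k$ if for every Galois $G$-algebra $M/L$, where $L$ is a field containing $k$, there exists a $k$-algebra homomorphism $\varphi:R\to L$ such that $S\otimes_\varphi L\cong M$ as $G$-algebras over $L$. *)

(* Defs.v *)
From HB Require Import structures.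
From mathcomp Require Import all_boot all_order all_algebra all_field.
From mathcomp Require Import fraction mpoly.
Set Implicit Arguments. Unset Strict Implicit. Unset Printing Implicit Defensive.
Import Order.TTheory GRing.Theory.
Local Open Scope ring_scope.

Definition ringhom_on (A B : nzRingType) (P : A -> Prop) (f : A -> B) : Prop :=
  [/\ forall x y, P x -> P y -> f (x + y) = f x + f y,
      forall x y, P x -> P y -> f (x * y) = f x * f y &
      f 1 = 1].
Definition ringhom (A B : nzRingType) (f : A -> B) : Prop :=
  ringhom_on (fun _ => True) f.

Section Setting.
Variables (F : finFieldType) (n m : nat).
Variable a : 'I_m -> 'M[F]_n.

Definition inA (g : 'M[F]_n) : Prop := exists c : 'I_m -> F, g = \sum_i c i *: a i.
Definition inG (g : 'M[F]_n) : Prop := inA g /\ g \in unitmx.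
Definition is_basis_of_subalgebra : Prop :=
  [/\ (forall c : 'I_m -> F, \sum_i c i *: a i = 0 -> forall i, c i = 0),
      inA 1%:M &
      (forall g h, inA g -> inA h -> inA (g *m h))].

Definition Pol := {mpoly F[m]}.
Definition Kfield := {fraction Pol}.
Local Notation "x %:F" := (@FracField.tofrac Pol x).
Definition embF (c : F) : Kfield := (c%:MP : Pol)%:F.
Definition Apoly : 'M[Pol]_n := \sum_(i < m) ('X_i : Pol) *: map_mx (fun c => (c%:MP : Pol)) (a i).
Definition dpoly : Pol := \det Apoly.
Definition AK : 'M[Kfield]_n := map_mx (fun p : Pol => p%:F) Apoly.
Definition inR (x : Kfield) : Prop := exists (p : Pol) (k : nat), x = p%:F / (dpoly%:F) ^+ k.

(* Galois G-extension S/R of commutative rings (Chase-Harrison-Rosenberg),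
   for a subring S of T and subring R of S, G = A^x acting via act *)
Definition GaloisExt (T : comNzRingType) (Rp Sp : T -> Prop)
  (act : 'M[F]_n -> T -> T) : Prop :=
  [/\ (forall x, Rp x -> Sp x),
      (forall g, inG g -> [/\ forall s, Sp s -> Sp (act g s),
                              ringhom_on Sp (act g) &
                              forall r, Rp r -> act g r = r]),
      (forall s, Sp s -> act 1%:M s = s),
      (forall g h s, inG g -> inG h -> Sp s -> act (g *m h) s = act g (act h s)) &
      (forall s, Sp s -> (forall g, inG g -> act g s = s) -> Rp s) /\
      exists (k : nat) (x y : 'I_k -> T), (forall i, Sp (x i) /\ Sp (y i)) /\
        forall g, inG g -> \sum_(i < k) x i * act g (y i) = (if g == 1%:M then 1 else 0)].

(* The G-algebra M over L (via jL) together with psi : S -> M is S (x)_phi L,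
   characterised by the universal property of the tensor product (pushout of
   commutative rings), with psi G-equivariant. *)
Definition is_base_change (E L M : comNzRingType) (iota : Kfield -> E) (Sp : E -> Prop)
  (phi : Kfield -> L) (jL : L -> M) (psi : E -> M)
  (act : 'M[F]_n -> E -> E) (actM : 'M[F]_n -> M -> M) : Prop :=
  [/\ ringhom_on Sp psi,
      (forall r, inR r -> psi (iota r) = jL (phi r)),
      (forall g s, inG g -> Sp s -> psi (act g s) = actM g (psi s)) &
      forall (T : comNzRingType) (alpha : E -> T) (beta : L -> T),
        ringhom_on Sp alpha -> ringhom beta ->
        (forall r, inR r -> alpha (iota r) = beta (phi r)) ->
        exists gamma : M -> T,
          [/\ ringhom gamma, (forall s, Sp s -> gamma (psi s) = alpha s),
              (forall l, gamma (jL l) = beta l) &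
              forall gamma' : M -> T, ringhom gamma' ->
                (forall s, Sp s -> gamma' (psi s) = alpha s) ->
                (forall l, gamma' (jL l) = beta l) -> gamma' =1 gamma]].

Definition generic (E : comNzRingType) (iota : Kfield -> E) (Sp : E -> Prop)
  (act : 'M[F]_n -> E -> E) : Prop :=
  forall (L : fieldType) (jF : F -> L), ringhom jF ->
  forall (M : comNzRingType) (jL : L -> M) (actM : 'M[F]_n -> M -> M),
    ringhom jL ->
    GaloisExt (fun x => exists l, x = jL l) (fun _ => True) actM ->
    exists phi : Kfield -> L,
      [/\ ringhom_on inR phi, (forall c, phi (embF c) = jF c) &
          exists psi : E -> M, is_base_change iota Sp phi jL psi act actM].

Section Ext.
Variables (E : fieldType) (iota : Kfield -> E) (U : 'M[E]_n).
Definition EF (c : F) : E := iota (embF c).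
Definition inGE : Prop :=
  (exists c : 'I_m -> E, U = \sum_i c i *: map_mx EF (a i)) /\ U \in unitmx.
Definition frobq (M : 'M[E]_n) : 'M[E]_n := map_mx (fun x => x ^+ #|F|) M.
Definition entries_separable : Prop :=
  forall i j, exists p : {poly Kfield},
    [/\ p != 0, separable_poly p & root (map_poly iota p) (U i j)].
Definition subfield_closed (P : E -> Prop) : Prop :=
  [/\ P 1, forall x y, P x -> P y -> P (x - y),
      forall x y, P x -> P y -> P (x * y) & forall x, P x -> P x^-1].
Definition generated_by_U : Prop :=
  forall P : E -> Prop, subfield_closed P -> (forall k, P (iota k)) ->
    (forall i j, P (U i j)) -> forall x, P x.
Definition subring_closed (P : E -> Prop) : Prop :=
  [/\ P 1, forall x y, P x -> P y -> P (x - y) & forall x y, P x -> P y -> P (x * y)].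
Definition inS (x : E) : Prop :=
  forall P : E -> Prop, subring_closed P -> (forall r, inR r -> P (iota r)) ->
    (forall i j, P (U i j)) -> P x.
Definition inRE (x : E) : Prop := exists r, inR r /\ x = iota r.
Definition Kaut (s : E -> E) : Prop :=
  [/\ ringhom s, bijective s & forall k, s (iota k) = iota k].
Definition galmap (s : E -> E) (g : 'M[F]_n) : Prop :=
  map_mx s U = U *m map_mx EF g.
End Ext.
End Setting.

(* Main.v *)
Require Import Defs.
From HB Require Import structures.
From mathcomp Require Import all_boot all_order all_algebra all_field.
From mathcomp Require Import fraction mpoly zify ring.
From Stdlib Require Import Classical ClassicalEpsilon.
Import Order.TTheory GRing.Theory.
Set Implicit Arguments. Unset Strict Implicit. Unset Printing Implicit Defensive.
Local Open Scope ring_scope.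

(* Write [U = \sum_i u_i a_i]. By [A = U (U^(q))^-1] the field [E] is [F(u)], and
   counting monomials shows that [u] is algebraically independent, as [t] is. So
   every other solution [U g] of [A X^(q) = X] is the image of [U] under an
   automorphism of [E] over [K], and Frobenius shows that all automorphisms arise so.

   The invariants of [S] are [R]: on the finite algebra, the monomials in the
   coordinates of [U Y] with exponents less than [q] are linearly independent
   functions of [Y], and this linearizes invariance into almost integrality over
   [F[t]], a completely integrally closed ring.

   Given a Galois algebra [M/L], a form of Hilbert 90 gives an invertible [V] over
   [M] with [sig g V = V g]. Then [V (V^(q))^-1] has entries in [L] and defines
   [phi], while [U |-> V] defines [S -> M]; a homomorphism of Galois extensions is
   a base change because elements are recovered from traces against the Galois
   coordinates. *)

(** * Evaluation of polynomials and Frobenius powers *)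

(** The units of the algebra form an open part of affine [m]-space, so a solution has as many
    coordinates as there are indeterminates, and independence can pass from [t] to [u]. Determinants
    in [A U^(q) = U] give [d = det(U)^(1-q)]: inverting [d] amounts to inverting [det U], so the
    only denominators met in [S] are powers of [det U], and a map from [S] to [M] needs only an
    invertible [V]. This matters because [M] may have zero divisors. Coordinates over [M] are
    therefore read off by linear forms with coefficients in [F], and invertibility is obtained from
    determinants and adjugates or by counting. The invariants must fall in [R] and not merely in
    [K]. Evaluating at all multiples [U Y], with [Y] any of the [q^m] elements of the algebra and
    not only a unit, gives exactly as many conditions as there are monomials with exponents less
    than [q]; a factor [det(U Y)] makes the non-units harmless. *)

Lemma ringhom_rmorphism (A B : nzRingType) (f : A -> B) :
  ringhom f -> exists f' : {rmorphism A -> B}, f = f'.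
Proof.
case=> fD fM f1.
have f0 : f 0 = 0.
  by apply: (addrI (f 0)); rewrite -fD // !addr0.
have fB : zmod_morphism f.
  by move=> x y; apply: (addIr (f y)); rewrite -fD // !subrK.
have fMM : monoid_morphism f by split=> // x y; apply: fM.
pose m := GRing.isZmodMorphism.Build A B f fB.
pose m' := GRing.isMonoidMorphism.Build A B f fMM.
pose f' : {rmorphism A -> B} := HB.pack f m m'.
by exists f'.
Qed.

Lemma rmorphism_ringhom (A B : nzRingType) (f : {rmorphism A -> B}) : ringhom f.
Proof. by split=> [x y _ _|x y _ _|]; rewrite ?rmorphD ?rmorphM ?rmorph1. Qed.

Lemma mmap_unique (R : nzRingType) (T : comNzRingType) m
    (h : {rmorphism R -> T}) (v : 'I_m -> T) (f : {rmorphism {mpoly R[m]} -> T}) :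
  (forall c, f c%:MP = h c) -> (forall i, f 'X_i = v i) -> f =1 mmap h v.
Proof.
move=> fC fX p; rewrite [p]mpolyE !raddf_sum /=; apply: eq_bigr => k _.
rewrite -mul_mpolyC !rmorphM /= fC mmapC; congr (_ * _).
rewrite mpolyXE_id !rmorph_prod /=; apply: eq_bigr => i _.
by rewrite !rmorphXn /= fX mmapX mmap1U.
Qed.

Lemma mmap_rmorph (R : nzRingType) (T T' : comNzRingType) m
    (h : {rmorphism R -> T}) (v : 'I_m -> T) (f : {rmorphism T -> T'}) p :
  f (mmap h v p) = mmap (f \o h) (f \o v) p.
Proof.
rewrite -[LHS]/((f \o mmap h v) p); apply: mmap_unique => [c|i] /=.
  by rewrite mmapC.
by rewrite mmapX mmap1U.
Qed.

Lemma eq_mmap (R : nzRingType) (T : comNzRingType) m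
    (h h' : R -> T) (v v' : 'I_m -> T) :
  h =1 h' -> v =1 v' -> mmap h v =1 mmap h' v'.
Proof.
move=> hh vv p; apply: eq_bigr => k _; rewrite hh; congr (_ * _).
by apply: eq_bigr => i _; rewrite vv.
Qed.

Section Frobenius.
Variables (F : finFieldType).

Lemma cardF_gt1 : (1 < #|F|)%N. Proof. exact: finNzRing_gt1. Qed.

Lemma pchar_cardF : exists2 p, p \in [pchar F] & exists e, #|F| = (p ^ e)%N.
Proof.
have [p p_pr pF] := finPcharP F; exists p => //.
by exists (logn p #|F|); apply: card_pprimeChar pF.
Qed.

Lemma pnat_cardF_exp (T : nzRingType) (h : {rmorphism F -> T}) k :
  [pchar T].-nat (#|F| ^ k)%N.
Proof.
have [p pF [e ->]] := pchar_cardF.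
have pT : p \in [pchar T] by rewrite (rmorph_pchar h).
rewrite (eq_pnat _ (pcharf_eq pT)) -expnM pnatX pnat_id ?orTb //.
exact: pcharf_prime pT.
Qed.

Definition qpow k (T : nzRingType) (x : T) : T := x ^+ (#|F| ^ k).

Lemma qpow_rmorphism (T : comNzRingType) (h : {rmorphism F -> T}) k :
  exists f : {rmorphism T -> T}, f = (@qpow k T) :> (T -> T).
Proof.
have [|f ->] := @ringhom_rmorphism T T (@qpow k T); last by exists f.
split=> [x y _ _|x y _ _|]; rewrite /qpow ?exprMn ?expr1n //.
by rewrite (exprDn_pchar _ _ (pnat_cardF_exp h k)).
Qed.

Lemma qpowF k (c : F) : qpow k c = c.
Proof.
by rewrite /qpow; elim: k => [|k IH]; rewrite ?expn0 ?expr1 // expnSr exprM IH expf_card.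
Qed.

(** Over [F] the polynomial [X^q - X] is the product of all [X - c]; in a field containing [F] its
    roots are therefore the elements of [F]. *)
Lemma qpow_fixed (T : fieldType) (h : {rmorphism F -> T}) (x : T) :
  x ^+ #|F| = x -> exists c, x = h c.
Proof.
move=> xq; have := congr1 (map_poly h) (finField_genPoly F).
rewrite rmorphB /= map_polyXn map_polyX rmorph_prod /=.
move/(congr1 (horner^~ x)); rewrite !hornerE xq subrr horner_prod.
move/esym/eqP; rewrite prodf_seq_eq0 => /hasP[c _ /=].
rewrite rmorphB /= map_polyX map_polyC !hornerE subr_eq0 => /eqP ->.
by exists c.
Qed.
End Frobenius.

(** * The algebra after extension of scalars *)

(** The flattened [a i] are independent rows, so the matrix they form has a right inverse, whose
    columns are the dual family. As its entries lie in [F], it gives coordinates over every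
    commutative [F]-algebra, compatible with all base changes. *)
Lemma dual_basis (F : fieldType) m n (a : 'I_m -> 'M[F]_n) :
  (forall c : 'I_m -> F, \sum_i c i *: a i = 0 -> forall i, c i = 0) ->
  exists kappa : 'I_m -> 'M[F]_n,
    forall i j, \sum_r \sum_s kappa i r s * a j r s = (i == j)%:R.
Proof.
move=> a_free; pose A := \matrix_i mxvec (a i).
have /row_freeP[B AB] : row_free A.
  rewrite -kermx_eq0; apply/eqP/row_matrixP => k; rewrite row0.
  have : row k (kermx A) *m A = 0 by rewrite -row_mul mulmx_ker row0.
  set c := row k _; rewrite mulmx_sum_row => cA.
  apply/rowP => i; rewrite [RHS]mxE; apply: (a_free (c 0)).
  apply: (can_inj mxvecK); rewrite linear0 -[RHS]cA linear_sum /=.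
  by apply: eq_bigr => j _; rewrite linearZ rowK.
exists (fun i => vec_mx (row i B^T)) => i j.
transitivity ((A *m B) j i); last by rewrite AB mxE eq_sym.
rewrite !mxE pair_big (reindex _ (curry_mxvec_bij _ _)) /=.
by apply: eq_bigr => -[r s] _ /=; rewrite !mxE mxvecE mulrC.
Qed.

Section Algebra.
Variables (F : finFieldType) (n m : nat) (a : 'I_m -> 'M[F]_n).
Variable kappa : 'I_m -> 'M[F]_n.
Hypothesis kappaP : forall i j, \sum_r \sum_s kappa i r s * a j r s = (i == j)%:R.
Hypothesis A1 : inA a 1%:M.
Hypothesis AM : forall g h, inA a g -> inA a h -> inA a (g *m h).

Definition elt (T : comNzRingType) (h : F -> T) (c : 'I_m -> T) : 'M[T]_n :=
  \sum_i c i *: map_mx h (a i).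
Definition inAT (T : comNzRingType) (h : F -> T) (X : 'M[T]_n) : Prop :=
  exists c, X = elt h c.
Definition acoord (T : comNzRingType) (h : F -> T) (i : 'I_m) (X : 'M[T]_n) : T :=
  \sum_r \sum_s h (kappa i r s) * X r s.

Section OneRing.
Variables (T : comNzRingType) (h : {rmorphism F -> T}).

Lemma acoord_is_linear i : scalar (acoord h i).
Proof.
move=> c X Y; rewrite /acoord mulr_sumr -big_split; apply: eq_bigr => r _ /=.
rewrite mulr_sumr -big_split; apply: eq_bigr => s _ /=.
by rewrite !mxE mulrDr mulrCA.
Qed.
HB.instance Definition _ i :=
  GRing.isLinear.Build T 'M[T]_n T *%R (acoord h i) (acoord_is_linear i).

Lemma acoord_a i j : acoord h i (map_mx h (a j)) = (i == j)%:R.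
Proof.
rewrite -(rmorph_nat h) -kappaP rmorph_sum; apply: eq_bigr => r _ /=.
by rewrite rmorph_sum; apply: eq_bigr => s _; rewrite mxE rmorphM.
Qed.

Lemma acoord_elt c i : acoord h i (elt h c) = c i.
Proof.
rewrite /elt linear_sum (bigD1 i) //= linearZ /= acoord_a eqxx mulr1.
by rewrite big1 ?addr0 // => j ji; rewrite linearZ /= acoord_a eq_sym (negPf ji) mulr0.
Qed.

Lemma elt_acoord X : inAT h X -> elt h (acoord h ^~ X) = X.
Proof.
by case=> c ->; apply: eq_bigr => i _; rewrite acoord_elt.
Qed.

Lemma inAT0 : inAT h 0.
Proof. by exists (fun=> 0); rewrite /elt big1 // => i _; rewrite scale0r. Qed.

Lemma inATD X Y : inAT h X -> inAT h Y -> inAT h (X + Y).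
Proof.
move=> [c ->] [d ->]; exists (fun i => c i + d i); rewrite /elt -big_split /=.
by apply: eq_bigr => i _; rewrite scalerDl.
Qed.

Lemma inATZ k X : inAT h X -> inAT h (k *: X).
Proof.
move=> [c ->]; exists (fun i => k * c i); rewrite /elt scaler_sumr.
by apply: eq_bigr => i _; rewrite scalerA.
Qed.

Lemma inAT_sum (I : Type) (r : seq I) (P : pred I) (G : I -> 'M[T]_n) :
  (forall i, P i -> inAT h (G i)) -> inAT h (\sum_(i <- r | P i) G i).
Proof. by move=> HG; elim/big_ind: _ => //; [exact: inAT0 | exact: inATD]. Qed.

Lemma inAT_inA g : inA a g -> inAT h (map_mx h g).
Proof.
move=> [c ->]; exists (h \o c); rewrite map_mx_sum; apply: eq_bigr => i _.
by rewrite map_mxZ.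
Qed.

Lemma inAT1 : inAT h 1%:M.
Proof. by rewrite -(map_mx1 h); exact: inAT_inA. Qed.

Lemma inA_a i : inA a (a i).
Proof.
exists (fun j => (i == j)%:R); rewrite (bigD1 i) //= eqxx scale1r big1 ?addr0 //.
by move=> j ji; rewrite eq_sym (negPf ji) scale0r.
Qed.

Lemma inATM X Y : inAT h X -> inAT h Y -> inAT h (X *m Y).
Proof.
move=> [c ->] [d ->]; rewrite /elt mulmx_suml; apply: inAT_sum => i _.
rewrite mulmx_sumr; apply: inAT_sum => j _.
rewrite -scalemxAl -scalemxAr -map_mxM; apply/inATZ/inATZ.
by apply: inAT_inA; apply: AM; apply: inA_a.
Qed.

End OneRing.

(** By Cayley-Hamilton, [det X] times the inverse of [X] is a polynomial in [X], and the span of the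
    algebra is closed under polynomials. As [det X] is a unit, this works over any commutative
    ring. *)
Lemma inAT_inv (T : comNzRingType) (h : {rmorphism F -> T}) (X Y : 'M[T]_n) :
  inAT h X -> X *m Y = 1%:M -> inAT h Y.
Proof.
have := inAT1 h; have := @inATM T h; have := inATZ (h := h); have := inATD (h := h).
move: X Y (@inAT0 T h); move: (inAT h); case: n => [|k] P X Y P0 PD PZ PM P1 PX XY.
  by rewrite (flatmx0 Y) -(flatmx0 1%:M).
have PH p : P (horner_mx X p).
  elim/poly_ind: p => [|p c IH]; first by rewrite rmorph0.
  rewrite rmorphD rmorphM /= horner_mx_X horner_mx_C; apply: PD; first exact: PM.
  by rewrite -scalemx1; apply: PZ.
set p := char_poly X; have : root (p - (p`_0)%:P) 0.
  by rewrite /root !hornerE horner_coef0 subrr.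
case/factor_theorem => r; rewrite subr0 => pE.
have : horner_mx X p = 0 by apply: Cayley_Hamilton.
rewrite -[p](subrK (p`_0)%:P) pE rmorphD rmorphM /= horner_mx_X horner_mx_C.
move/(congr1 (mulmx^~ Y)); rewrite mul0mx mulmxDl -mulmxA XY mulmx1.
rewrite mul_scalar_mx char_poly_det => /eqP; rewrite addr_eq0 => /eqP rE.
have dXY : \det X * \det Y = 1 by rewrite -det_mulmx XY det1.
have -> : Y = ((-1) ^+ k.+1 * \det Y) *: ((-1) ^+ k.+1 * \det X *: Y).
  rewrite scalerA mulrACA -expr2 sqrr_sign mul1r [_ * \det X]mulrC dXY.
  by rewrite scale1r.
apply: (PZ); rewrite -[X in P X]opprK -rE -scaleN1r; exact: PZ.
Qed.

Section Map.
Variables (T T' : comNzRingType) (h : {rmorphism F -> T}) (f : {rmorphism T -> T'}).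

Lemma acoord_map i X : acoord (f \o h) i (map_mx f X) = f (acoord h i X).
Proof.
rewrite rmorph_sum; apply: eq_bigr => r _; rewrite rmorph_sum /=.
by apply: eq_bigr => s _; rewrite mxE rmorphM.
Qed.

Lemma elt_map c : map_mx f (elt h c) = elt (f \o h) (f \o c).
Proof.
rewrite map_mx_sum; apply: eq_bigr => i _.
by rewrite map_mxZ -map_mx_comp.
Qed.

Lemma inAT_map X : inAT h X -> inAT (f \o h) (map_mx f X).
Proof. by move=> [c ->]; exists (f \o c); rewrite elt_map. Qed.
End Map.

Lemma map_Apoly (T : comNzRingType) (h : {rmorphism F -> T}) (v : 'I_m -> T) :
  map_mx (mmap h v) (Apoly a) = elt h v.
Proof.
rewrite map_mx_sum; apply: eq_bigr => i _.
rewrite map_mxZ /= mmapX mmap1U -map_mx_comp; congr (_ *: _).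
by apply: eq_map_mx => c /=; rewrite mmapC.
Qed.

Lemma mmap_dpoly (T : comNzRingType) (h : {rmorphism F -> T}) (v : 'I_m -> T) :
  mmap h v (dpoly a) = \det (elt h v).
Proof. by rewrite -map_Apoly det_map_mx. Qed.

Lemma elt_eq (T : comNzRingType) (h h' : F -> T) c c' :
  h =1 h' -> c =1 c' -> elt h c = elt h' c'.
Proof.
move=> hh cc; apply: eq_bigr => i _; rewrite cc; congr (_ *: _).
exact: eq_map_mx.
Qed.

Lemma inAT_eq (T : comNzRingType) (h h' : F -> T) X :
  h =1 h' -> inAT h X -> inAT h' X.
Proof. by move=> hh [c ->]; exists c; apply: elt_eq. Qed.

Lemma acoord_eq (T : comNzRingType) (h h' : F -> T) i X :
  h =1 h' -> acoord h i X = acoord h' i X.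
Proof.
by move=> hh; apply: eq_bigr => r _; apply: eq_bigr => s _; rewrite hh.
Qed.
End Algebra.

(** * Transfer of algebraic dependence by counting monomials *)

Definition alg_independent (R : nzRingType) (T : comNzRingType) m
    (h : R -> T) (u : 'I_m -> T) : Prop :=
  forall P : {mpoly R[m]}, mmap h u P = 0 -> P = 0.

Section Counting.
Variables (F E : fieldType) (m : nat) (e : {rmorphism F -> E}) (u : 'I_m -> E).
Variable Q : {mpoly F[m]}.
Hypotheses (Q_neq0 : Q != 0) (Qu : mmap e u Q = 0).
Local Notation mu := (mlead Q).

(** Exponents of the monomials that division by [Q] leaves alone, those not divisible by its leading
    monomial, in a box of side [M + 1]. *)
Definition standard_exps M : {set {ffun 'I_m -> 'I_M.+1}} :=
  [set f : {ffun 'I_m -> 'I_M.+1} | [exists j, (f j < mu j)%N]].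

(** Some exponent [f j] is less than [mu j], while the other [m - 1] are free: the bound has one
    power of [M + 1] less than the whole box. *)
Lemma card_standard_exps M : (#|standard_exps M| <= mdeg mu * M.+1 ^ m.-1)%N.
Proof.
pose Bj (j : 'I_m) := [set f : {ffun 'I_m -> 'I_M.+1} | (f j < mu j)%N].
have -> : standard_exps M = \bigcup_j Bj j.
  apply/setP => f; rewrite inE; apply/existsP/bigcupP => [[j]|[j _]].
    by exists j; rewrite ?inE.
  by rewrite inE; exists j.
apply: leq_trans (_ : \sum_j #|Bj j| <= _)%N.
  elim/big_rec2: _ => [|i x y _ IH]; first by rewrite cards0.
  by apply: leq_trans (leq_card_setU _ _) _; rewrite leq_add2l.
rewrite mdegE big_distrl /=; apply: leq_sum => j _.
pose Fj (i : 'I_m) : pred 'I_M.+1 := fun x => (i == j) ==> (x < mu j)%N.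
have -> : #|Bj j| = #|family Fj|.
  apply: eq_card => f; rewrite inE; apply/idP/familyP => [fj i | /(_ j)].
    by rewrite unfold_in; apply/implyP => /eqP ->.
  by rewrite unfold_in eqxx.
rewrite card_family foldrE big_map big_enum /= (bigD1 j) //=.
apply: leq_mul.
  have -> : #|Fj j| = #|[pred x : 'I_M.+1 | (x < mu j)%N]|.
    by apply: eq_card => x; rewrite unfold_in eqxx.
  case: (mu j) => [|k]; first by rewrite eq_card0.
  rewrite -[leqRHS]card_ord; apply: (@leq_card_in _ _ (fun x : 'I_M.+1 => inord x : 'I_k.+1)).
  move=> x y; rewrite !inE => xk yk /(congr1 val) /=.
  by rewrite !inordK // => /val_inj.
rewrite (eq_bigr (fun=> M.+1)); last first.
  move=> i ij; rewrite -[RHS]card_ord; apply: eq_card => x.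
  by rewrite unfold_in (negPf ij).
by rewrite prod_nat_const cardC1 card_ord.
Qed.

Definition in_span M (x : E) : Prop := exists c : {ffun 'I_m -> 'I_M.+1} -> F,
  x = \sum_(f in standard_exps M) e (c f) * \prod_j u j ^+ f j.

Lemma in_span0 M : in_span M 0.
Proof. by exists (fun=> 0); rewrite big1 // => f _; rewrite rmorph0 mul0r. Qed.

Lemma in_spanD M x y : in_span M x -> in_span M y -> in_span M (x + y).
Proof.
move=> [c ->] [d ->]; exists (fun f => c f + d f); rewrite -big_split.
by apply: eq_bigr => f _; rewrite rmorphD mulrDl.
Qed.

Lemma in_spanZ M k x : in_span M x -> in_span M (e k * x).
Proof.
move=> [c ->]; exists (fun f => k * c f); rewrite mulr_sumr.
by apply: eq_bigr => f _; rewrite rmorphM mulrA.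
Qed.

Lemma in_span_sum M (I : eqType) (r : seq I) (P : pred I) (G : I -> E) :
  (forall i, i \in r -> P i -> in_span M (G i)) -> in_span M (\sum_(i <- r | P i) G i).
Proof.
move=> HG; rewrite big_seq_cond.
elim/big_ind: _ => [|x y|i /andP[]]; [exact: in_span0 | exact: in_spanD | exact: HG].
Qed.

(* Division by [Q] does not raise the degree, as the order on monomials refines
   the total degree. *)
Lemma in_span_mnm M k : (mdeg k <= M)%N -> in_span M (mmap1 u k).
Proof.
elim/(ltmwf (n := m)): k => k IH kM.
have k_le j : (k j < M.+1)%N.
  by rewrite ltnS (leq_trans _ kM) // mdegE (bigD1 j) //= leq_addr.
case: (boolP (mu <= k)%MM) => [mu_k | nmu_k]; last first.
  pose f : {ffun 'I_m -> 'I_M.+1} := [ffun j => inord (k j)].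
  have fB : f \in standard_exps M.
    rewrite inE; apply: contraNT nmu_k => /existsPn nf.
    by apply/mnm_lepP => j; rewrite leqNgt; have := nf j; rewrite ffunE inordK.
  exists (fun f' => (f' == f)%:R); rewrite (bigD1 f) //= eqxx rmorph1 mul1r.
  rewrite [X in _ + X]big1 ?addr0 => [|f' /andP[_ /negPf ->]]; last first.
    by rewrite rmorph0 mul0r.
  by apply: eq_bigr => j _; rewrite ffunE inordK.
rewrite -(submK mu_k) addmC; set nu := (k - mu)%MM.
have kE : k = (mu + nu)%MM by rewrite addmC submK.
have lc0 : Q@_mu != 0 by rewrite mleadc_eq0.
have uM p1 p2 : mmap1 u (p1 + p2)%MM = mmap1 u p1 * mmap1 u p2.
  by apply: commr_mmap1_M => i x; apply: mulrC.
have : e (Q@_mu) * mmap1 u mu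
       = - \sum_(p <- msupp Q | p != mu) e Q@_p * mmap1 u p.
  apply/eqP; rewrite -addr_eq0; apply/eqP; rewrite -[RHS]Qu [RHS](bigD1_seq mu) //=.
    exact: mlead_supp.
move/(congr1 (fun x => e (Q@_mu)^-1 * x * mmap1 u nu)).
rewrite mulrA -rmorphM mulVf // rmorph1 mul1r uM => ->.
rewrite -mulrA; apply: in_spanZ; rewrite mulNr mulr_suml -sumrN.
apply: in_span_sum => p pQ p_mu; rewrite -mulrA -mulNr -rmorphN; apply: in_spanZ.
rewrite -uM.
have lt_p : ((p + nu)%MM < k)%O.
  by rewrite kE ltmc_add2l lt_neqAle p_mu msupp_le_mlead.
apply: IH => //; apply: leq_trans (lemc_mdeg (ltW lt_p)) kM.
Qed.

Lemma in_span_mmap M P : (msize P <= M.+1)%N -> in_span M (mmap e u P).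
Proof.
move=> PM; apply: in_span_sum => k kP _; apply: in_spanZ; apply: in_span_mnm.
by rewrite -ltnS; apply: leq_trans PM; apply: msize_mdeg_lt.
Qed.

Lemma msize_prod_leq (I : Type) (r : seq I) (P : pred I) (G : I -> {mpoly F[m]}) d :
  (forall i, P i -> (msize (G i) <= d.+1)%N) ->
  (msize (\prod_(i <- r | P i) G i) <= (size r * d).+1)%N.
Proof.
move=> HG; elim: r => [|i r IH]; first by rewrite big_nil msize1.
rewrite big_cons; case: ifP => Pi; last first.
  by apply: leq_trans IH _; rewrite ltnS leq_mul // leqW.
have [->|G0] := eqVneq (G i) 0; first by rewrite mul0r msize0.
have [->|H0] := eqVneq (\prod_(j <- r | P j) G j) 0; first by rewrite mulr0 msize0.
rewrite msizeM //= mulSn; move: (HG i Pi) IH.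
move: (msize (G i)) (msize (\prod_(j <- r | P j) G j)) => x y; lia.
Qed.

(* Compare the [N ^ m] monomials in [t] of partial degrees less than [N], each
   multiplied by a common denominator, with the [O(N ^ (m - 1))] monomials in [u]
   that span the polynomials in [u] of degree [O(N)]. *)
Lemma alg_dependent_transfer (t : 'I_m -> E) (D : {mpoly F[m]})
    (Ps : 'I_m -> {mpoly F[m]}) :
  mmap e u D != 0 -> (forall i, t i * mmap e u D = mmap e u (Ps i)) ->
  exists2 p, p != 0 & mmap e t p = 0.
Proof.
move=> D0 tD; pose d := (msize D + \sum_i msize (Ps i))%N.
have Dd : (msize D <= d.+1)%N by rewrite /d; lia.
have Pd i : (msize (Ps i) <= d.+1)%N.
  by rewrite /d (bigD1 i) //=; lia.
(* [M] bounds the degree of the products [R al] below, and [M + 1 <= N (m d + 1)]. As [N] exceeds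
   [s (m d + 1)^(m-1)], the at most [s (M + 1)^(m-1)] standard monomials are fewer than [N^m]. *)
pose s := mdeg mu; pose N := (s * (m * d).+1 ^ m.-1).+1.
pose M := (m * (N * d))%N.
have ltN : (#|standard_exps M| < #|{ffun 'I_m -> 'I_N}|)%N.
  rewrite card_ffun !card_ord; apply: leq_ltn_trans (card_standard_exps M) _.
  case: (posnP m) => [m0|m_gt0].
    by rewrite mdegE big1 ?mul0n ?expn_gt0 // => i; have := ltn_ord i; rewrite {2}m0.
  apply: leq_ltn_trans (_ : s * (N * (m * d).+1) ^ m.-1 < _)%N.
    rewrite leq_mul2l; apply/orP; right; case: (posnP m.-1) => [->|m1] //.
    by rewrite leq_exp2r // /M; nia.
  rewrite expnMn -[in ltnRHS](prednK m_gt0) expnS mulnCA mulnC.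
  by rewrite ltn_pmul2r ?expn_gt0.
(* At [u] this is [t^al] times [D^(m N)]: the denominator cleared is the same for every [al], so it
   can be cancelled from a linear relation. *)
pose R (al : {ffun 'I_m -> 'I_N}) := \prod_i (Ps i ^+ al i * D ^+ (N - al i)).
have RM al : (msize (R al) <= M.+1)%N.
  have sz k : size (index_enum 'I_k) = k by rewrite /index_enum -enumT size_enum_ord.
  have := @msize_prod_leq _ (index_enum 'I_m) xpredT
    (fun i => Ps i ^+ al i * D ^+ (N - al i)) (N * d); rewrite sz.
  apply => i _.
  have bnd (G : {mpoly F[m]}) k : (msize G <= d.+1)%N -> (msize (G ^+ k) <= (k * d).+1)%N.
    move=> Gd; have := @msize_prod_leq _ (index_enum 'I_k) xpredT (fun=> G) d (fun _ _ => Gd).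
    by rewrite sz prodr_const card_ord.
  have := bnd _ (al i) (Pd i); have := bnd _ (N - al i)%N Dd.
  set x := Ps i ^+ _; set y := D ^+ _.
  have [->|x0] := eqVneq x 0; first by rewrite mul0r msize0.
  have [->|y0] := eqVneq y 0; first by rewrite mulr0 msize0.
  rewrite msizeM //; have := ltn_ord (al i); move: (nat_of_ord (al i)) (msize x) (msize y).
  move=> k X Y; nia.
have Ru al : mmap e u (R al) = mmap1 t [multinom (al i : nat) | i < m] * mmap e u D ^+ (m * N).
  rewrite rmorph_prod /= mulnC exprM -[X in _ * _ ^+ X]card_ord -prodr_const -big_split /=.
  apply: eq_bigr => i _; rewrite mnmE rmorphM !rmorphXn /= -tD exprMn -mulrA.
  by rewrite -exprD subnKC // ltnW.
have /fin_all_exists[c cP] : forall al, exists c, mmap e u (R al) =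
    \sum_(f in standard_exps M) e (c f) * \prod_j u j ^+ (nat_of_ord (f j)).
  by move=> al; apply: in_span_mmap.
(* There are more rows than columns, so the left kernel contains a nonzero row; its entries are the
   coefficients of the polynomial [p] sought. *)
pose C := \matrix_(i < #|{ffun 'I_m -> 'I_N}|, j < #|standard_exps M|)
  c (enum_val i) (enum_val j).
have : kermx C != 0.
  rewrite kermx_eq0 /row_free neq_ltn; apply/orP; left.
  by apply: leq_ltn_trans (rank_leq_col _) ltN.
case/matrix0Pn => i0 [j0 r0]; pose r := row i0 (kermx C).
have rC : r *m C = 0 by rewrite -row_mul mulmx_ker row0.
pose p : {mpoly F[m]} := \sum_al r 0 (enum_rank al) *: 'X_[[multinom (al i : nat) | i < m]].
have pE (al : {ffun 'I_m -> 'I_N}) : p@_[multinom (al i : nat) | i < m] = r 0 (enum_rank al).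
  rewrite raddf_sum /= (bigD1 al) //= mcoeffZ mcoeffX eqxx mulr1 big1 ?addr0 //.
  move=> be be_al; rewrite mcoeffZ mcoeffX; case: eqP => [/mnmP eq_al|]; last by rewrite mulr0.
  case/eqP: be_al; apply/ffunP => i; apply: val_inj.
  by have := eq_al i; rewrite !mnmE.
exists p.
  apply: contraNneq r0 => p0; have := pE (enum_val j0); rewrite p0 mcoeff0 enum_valK.
  by rewrite /r mxE => <-.
apply: (mulIf (expf_neq0 (m * N) D0)); rewrite mul0r raddf_sum mulr_suml /=.
transitivity (\sum_al e (r 0 (enum_rank al)) * mmap e u (R al)).
  by apply: eq_bigr => al _; rewrite mmapZ mmapX -mulrA Ru.
rewrite (eq_bigr _ (fun al _ => congr1 _ (cP al))).
rewrite (eq_bigr (fun al => \sum_(f in standard_exps M)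
   e (r 0 (enum_rank al) * c al f) * \prod_j u j ^+ (nat_of_ord (f j)))); last first.
  by move=> al _; rewrite mulr_sumr; apply: eq_bigr => f _; rewrite rmorphM mulrA.
rewrite exchange_big /= big1 // => f fB; rewrite -mulr_suml -rmorph_sum /=.
have /rowP/(_ (enum_rank_in fB f)) := rC; rewrite !mxE => rCf.
rewrite [X in e X](_ : _ = 0) ?rmorph0 ?mul0r // -[RHS]rCf.
rewrite [RHS](reindex (@enum_rank {ffun 'I_m -> 'I_N})) /=; last first.
  exact: onW_bij (@enum_rank_bij _).
by apply: eq_bigr => al _; rewrite [C _ _]mxE enum_rankK enum_rankK_in.
Qed.
End Counting.

(** * Homomorphisms defined on fractions *)

Lemma fracP (R : idomainType) (x : {fraction R}) :
  exists p q, q != 0 /\ x = tofrac p / tofrac q.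
Proof.
suff [p [q [q0 xq]]] : exists p q, q != 0 /\ x * tofrac q = tofrac p.
  by exists p, q; split=> //; rewrite -xq mulfK // tofrac_eq0.
elim/quotW: x => r; exists (\n_r), (\d_r); split; first exact: denom_ratioP.
rewrite -[_ * _]/(FracField.mul _ _) !piE; apply/eqmodP; rewrite /= FracField.equivfE.
by rewrite /FracField.mulf !numden_Ratio ?mulr1 ?oner_neq0 ?denom_ratioP // mulrC.
Qed.

Lemma tofrac_divK (R : idomainType) (p d : R) k :
  d != 0 -> tofrac p / tofrac d ^+ k * tofrac (d ^+ k) = tofrac p.
Proof. by move=> d0; rewrite tofracXn divfK // expf_neq0 // tofrac_eq0. Qed.

Lemma mmap_closed (R : nzRingType) (T : comNzRingType) m (h : {rmorphism R -> T})
    (v : 'I_m -> T) (P : T -> Prop) :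
  (forall x y, P x -> P y -> P (x + y)) -> (forall x y, P x -> P y -> P (x * y)) ->
  (forall c, P (h c)) -> (forall i, P (v i)) -> forall p, P (mmap h v p).
Proof.
move=> PD PM Ph Pv p; rewrite /mmap.
have P0 : P 0 by rewrite -(rmorph0 h).
have P1 : P 1 by rewrite -(rmorph1 h).
apply: (big_ind P); [exact: P0 | exact: PD | move=> k _]; apply: (PM) => //; rewrite /mmap1.
apply: (big_ind P); [exact: P1 | exact: PM | move=> i _]; elim: (k i) => [|j IH]; rewrite ?expr0 // exprS.
exact: PM.
Qed.

Lemma mpoly_ring_ind (R : comNzRingType) m (P : {mpoly R[m]} -> Prop) :
  (forall p p', P p -> P p' -> P (p + p')) -> (forall p p', P p -> P p' -> P (p * p')) ->
  (forall c, P c%:MP) -> (forall i, P 'X_i) -> forall p, P p.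
Proof.
move=> PD PM PC PX p.
have -> : p = mmap (@mpolyC m R) (fun i => 'X_i) p.
  exact: (@mmap_unique _ _ _ (@mpolyC m R) (fun i => 'X_i) (idfun : {rmorphism _ -> _})).
exact: mmap_closed.
Qed.

Section FractionExtension.
Variables (R : nzRingType) (E : idomainType) (T : comNzRingType) (m : nat).
Variables (e : {rmorphism R -> E}) (u : 'I_m -> E).
Variables (h : {rmorphism R -> T}) (v : 'I_m -> T).
Variable D : {mpoly R[m]} -> Prop.
Hypothesis u_indep : alg_independent e u.
Hypotheses (D1 : D 1) (DM : forall P Q, D P -> D Q -> D (P * Q)).
Hypothesis D_inv : forall Q, D Q -> exists w, mmap h v Q * w = 1.

Definition is_frac (x : E) : Prop :=
  exists P Q, D Q /\ x * mmap e u Q = mmap e u P.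

Lemma is_fracD x y : is_frac x -> is_frac y -> is_frac (x + y).
Proof.
move=> [P [Q [DQ xQ]]] [P' [Q' [DQ' yQ']]]; exists (P * Q' + P' * Q), (Q * Q').
by split; [apply: DM | rewrite !(rmorphM, rmorphD) /= -xQ -yQ'; ring].
Qed.

Lemma is_fracM x y : is_frac x -> is_frac y -> is_frac (x * y).
Proof.
move=> [P [Q [DQ xQ]]] [P' [Q' [DQ' yQ']]]; exists (P * P'), (Q * Q').
by split; [apply: DM | rewrite !rmorphM /= -xQ -yQ'; ring].
Qed.

Lemma is_frac_mmap P : is_frac (mmap e u P).
Proof. by exists P, 1; rewrite rmorph1 mulr1. Qed.

Lemma is_frac_const c : is_frac (e c).
Proof. by have := is_frac_mmap c%:MP; rewrite mmapC. Qed.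

Lemma D_cancel Q x y : D Q -> x * mmap h v Q = y * mmap h v Q -> x = y.
Proof.
move=> /D_inv[w Qw] /(congr1 ( *%R^~ w)).
by rewrite /= -!mulrA Qw !mulr1.
Qed.

(** Independence of [u] makes the value [P(v) / Q(v)] independent of the chosen fraction. The
    denominators are restricted to [D] because [T] may have zero divisors: [D] will be all nonzero
    polynomials for maps of [E], and the powers of [dpoly a] for maps out of [R] or [S]. Outside the
    fractions [f] is arbitrary. *)
Lemma frac_extension : exists f : E -> T,
  [/\ ringhom_on is_frac f, forall P, f (mmap e u P) = mmap h v P &
      forall x P Q, D Q -> x * mmap e u Q = mmap e u P ->
        f x * mmap h v Q = mmap h v P].
Proof.
pose good x y := forall P Q, D Q -> x * mmap e u Q = mmap e u P ->
  y * mmap h v Q = mmap h v P.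
have ex_good x : exists y, good x y.
  case: (classic (is_frac x)) => [[P [Q [DQ xQ]]]|nx]; last first.
    by exists 0 => P Q DQ xQ; case: nx; exists P, Q.
  have [w Qw] := D_inv DQ; exists (mmap h v P * w) => P' Q' DQ' xQ'.
  have /(congr1 (mmap h v)) : P * Q' = P' * Q.
    apply/eqP; rewrite -subr_eq0; apply/eqP/u_indep; rewrite rmorphB !rmorphM /=.
    by rewrite -xQ -xQ' mulrAC subrr.
  rewrite !rmorphM /= => PQ'.
  by rewrite mulrAC PQ' -mulrA Qw mulr1.
pose f x := epsilon (inhabits 0) (good x).
have fP x : good x (f x) by apply: epsilon_spec; exact: ex_good.
have f_poly P : f (mmap e u P) = mmap h v P.
  apply: (D_cancel D1); rewrite -[RHS]rmorphM /= mulr1.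
  by apply: fP; rewrite // rmorph1 mulr1.
exists f; split=> //; split.
- move=> x y [P [Q [DQ xQ]]] [P' [Q' [DQ' yQ']]].
  apply: (D_cancel (DM DQ DQ')); rewrite (fP (x + y) (P * Q' + P' * Q)).
  + rewrite mulrDl !(rmorphM, rmorphD) /= mulrA (fP _ _ _ DQ xQ); congr (_ + _).
    by rewrite mulrCA (fP _ _ _ DQ' yQ') mulrC.
  + exact: DM.
  + by rewrite !(rmorphM, rmorphD) /= -xQ -yQ'; ring.
- move=> x y [P [Q [DQ xQ]]] [P' [Q' [DQ' yQ']]].
  apply: (D_cancel (DM DQ DQ')); rewrite (fP (x * y) (P * P')).
  + by rewrite !rmorphM /= mulrACA (fP _ _ _ DQ xQ) (fP _ _ _ DQ' yQ').
  + exact: DM.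
  + by rewrite !rmorphM /= -xQ -yQ'; ring.
- by rewrite -[X in f X](rmorph1 (mmap e u)) f_poly rmorph1.
Qed.
End FractionExtension.

(** * Cartier operators and reduction of exponents *)

Section CartierOperator.
Variables (F : finFieldType) (m k : nat) (alpha : 'X_{1..m}).
Local Notation Q := (#|F| ^ k)%N.
Implicit Types (p s t : {mpoly F[m]}) (b g : 'X_{1..m}).

(** Value on monomials of the operator that keeps the exponents congruent to [alpha] modulo [Q],
    removes [alpha] and takes a [Q]-th root. *)
Definition cartier_mnm g : {mpoly F[m]} :=
  if [forall j, (g j %% Q)%N == alpha j] then 'X_[[multinom (g j %/ Q)%N | j < m]] else 0.

(** The sum is over all exponents of degree less than [d], not over the support of [p], so that
    linearity is immediate; [d] need only be large enough. *)
Definition cartier d p : {mpoly F[m]} :=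
  \sum_(g : 'X_{1..m < d}) p@_g *: cartier_mnm g.

Lemma cartier_is_linear d : linear (cartier d).
Proof.
move=> c p s; rewrite /cartier scaler_sumr -big_split; apply: eq_bigr => g _ /=.
by rewrite mcoeffD mcoeffZ scalerDl scalerA.
Qed.
HB.instance Definition _ d :=
  GRing.isLinear.Build F {mpoly F[m]} {mpoly F[m]} *:%R (cartier d) (cartier_is_linear d).

Lemma cartierX d g : (mdeg g < d)%N -> cartier d 'X_[g] = cartier_mnm g.
Proof.
move=> gd; rewrite /cartier (bigD1 (BMultinom gd)) //= mcoeffX eqxx scale1r.
rewrite big1 ?addr0 // => g' /negPf g'g; rewrite mcoeffX [g == _]eq_sym.
by rewrite -(inj_eq val_inj) /= in g'g; rewrite g'g scale0r.
Qed.

Lemma cartier_mnmM b g : cartier_mnm (b *+ Q + g)%MM = 'X_[b] * cartier_mnm g.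
Proof.
have Q0 : (0 < Q)%N by rewrite expn_gt0 (ltnW (cardF_gt1 F)).
rewrite /cartier_mnm.
have -> : [forall j, ((b *+ Q + g)%MM j %% Q)%N == alpha j] = [forall j, (g j %% Q)%N == alpha j].
  by apply: eq_forallb => j; rewrite mnmDE mulmnE modnMDl.
case: ifP => _; last by rewrite mulr0.
rewrite -mpolyXD; congr mpolyX; apply/mnmP => j.
by rewrite !(mnmDE, mnmE) mulmnE divnMDl.
Qed.

Lemma mpoly_qpow t : t ^+ Q = \sum_(b <- msupp t) t@_b *: 'X_[(b *+ Q)%MM].
Proof.
have [f fE] := qpow_rmorphism (@mpolyC m F) k.
rewrite {1}[t]mpolyE -[_ ^+ _]/(qpow F k _) -fE rmorph_sum /=; apply: eq_bigr => b _.
rewrite fE /qpow exprZn mpolyXn; congr (_ *: _).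
exact: qpowF.
Qed.

(** A [Q]-th power comes out of the operator as its root: raising [t] to the power [Q] multiplies
    exponents by [Q] and fixes the coefficients, which lie in [F]. The bound on [d] covers the
    degree of the product. *)
Lemma cartierMqpow d s t : (msize s + Q * msize t <= d)%N ->
  cartier d (s * t ^+ Q) = t * \sum_(g <- msupp s) s@_g *: cartier_mnm g.
Proof.
move=> dP; rewrite mpoly_qpow {1}[s]mpolyE !mulr_suml linear_sum /= mulr_sumr.
apply: eq_big_seq => g gs; rewrite mulr_sumr linear_sum {3}[t]mpolyE mulr_suml /=.
apply: eq_big_seq => b bt; rewrite -!scalerAl -!scalerAr !linearZ /=; congr (_ *: (_ *: _)).
rewrite -mpolyXD addmC cartierX ?cartier_mnmM // mdegD mdegMn.
have := msize_mdeg_lt gs; have := msize_mdeg_lt bt; move: dP.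
move: (mdeg b) (mdeg g) (msize s) (msize t) Q => x y z w r; nia.
Qed.
End CartierOperator.

(* A polynomial ring over a finite field is completely integrally closed: since
   [c] has degree less than [Q], the Cartier operator attached to a monomial of
   [c] turns [c * p ^ Q = w * c ^ Q] into a multiple of [p] equal to a multiple
   of [c]. *)
Lemma dvd_of_qpow (F : finFieldType) m (c p : {mpoly F[m]}) : c != 0 ->
  (forall k, exists w, c * p ^+ (#|F| ^ k) = w * c ^+ (#|F| ^ k)) -> exists r, p = c * r.
Proof.
move=> c0 cpw; pose k := msize c; have [w cw] := cpw k.
have kQ : (k < #|F| ^ k)%N by rewrite ltn_expl // cardF_gt1.
pose al := mlead c; have al_c : al \in msupp c by apply: mlead_supp.
set Q := (#|F| ^ k)%N in cw kQ; pose G s := \sum_(g <- msupp s) s@_g *: cartier_mnm F k al g.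
have Gc : G c = (c@_al)%:MP.
  rewrite /G (bigD1_seq al) //= ?msupp_uniq // big_seq_cond big1 ?addr0.
    rewrite /cartier_mnm.
    have small j : (al j < Q)%N.
      apply: leq_ltn_trans (ltn_trans (msize_mdeg_lt al_c) kQ).
      by rewrite mdegE (bigD1 j) //= leq_addr.
    case: ifP => [_|/negP[]]; last by apply/forallP => j; rewrite modn_small.
    rewrite (_ : [multinom _ | j < m] = 0%MM) ?mpolyX0 ?alg_mpolyC //.
      by apply/mnmP => j; rewrite mnmE mnm0E divn_small.
  move=> g /andP[gc g_al]; rewrite /cartier_mnm; case: ifP => [/forallP g_eq|]; last by rewrite scaler0.
  case/eqP: g_al; apply/mnmP => j; rewrite -(eqP (g_eq j)) modn_small //.
  apply: leq_ltn_trans (ltn_trans (msize_mdeg_lt gc) kQ).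
  by rewrite mdegE (bigD1 j) //= leq_addr.
pose d := (msize c + Q * msize p + (msize w + Q * msize c))%N.
have := congr1 (cartier k al d) cw.
rewrite !cartierMqpow ?leq_addr ?leq_addl // -/(G c) -/(G w) Gc => pc.
exists ((c@_al)^-1 *: G w); rewrite -scalerAr -pc mulrC mul_mpolyC scalerA mulVf ?scale1r //.
by rewrite mleadc_eq0.
Qed.

Section Reduction.
Variables (R T : comNzRingType) (h : {rmorphism R -> T}) (m q : nat).
Variable B : 'I_m -> 'I_m -> R.
Hypothesis q_gt1 : (1 < q)%N.

Definition frob_solution (v : 'I_m -> T) : Prop :=
  forall j, v j ^+ q = \sum_l h (B j l) * v l.
Definition small_mnm (v : 'I_m -> T) (al : {ffun 'I_m -> 'I_q}) : T :=
  \prod_j v j ^+ al j.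
(* The coefficients [k] do not depend on the solution [v]. *)
Definition reducible (f : ('I_m -> T) -> T) : Prop := exists k : {ffun 'I_m -> 'I_q} -> R,
  forall v, frob_solution v -> f v = \sum_al h (k al) * small_mnm v al.

Lemma reducible_sum (I : eqType) (r : seq I) (c : I -> R) (f : I -> ('I_m -> T) -> T) :
  (forall i, i \in r -> reducible (f i)) -> reducible (fun v => \sum_(i <- r) h (c i) * f i v).
Proof.
elim: r => [|i r IH] fr.
  by exists (fun=> 0) => v _; rewrite big_nil big1 // => al _; rewrite rmorph0 mul0r.
have [|k kP] := IH; first by move=> j jr; apply: fr; rewrite inE jr orbT.
have [|k' kP'] := fr i; first by rewrite inE eqxx.
exists (fun al => c i * k' al + k al) => v vP.
rewrite big_cons kP // kP' // mulr_sumr -big_split; apply: eq_bigr => al _ /=.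
by rewrite rmorphD rmorphM mulrDl mulrA.
Qed.

(** Replacing a factor [v_j^q] by a linear form in [v] lowers the degree, as [q > 1]; induction on
    the degree ends with all exponents below [q]. *)
Lemma reducible_mnm g : reducible (fun v => mmap1 v g).
Proof.
have [d] := ubnP (mdeg g); elim: d g => // d IH g; rewrite ltnS => gd.
have [/existsP[j qj]|/existsPn small] := boolP [exists j, q <= g j]%N; last first.
  have lt_q j : (g j < q)%N by rewrite ltnNge small.
  pose al : {ffun 'I_m -> 'I_q} := [ffun j => Ordinal (lt_q j)].
  exists (fun be => (be == al)%:R) => v _; rewrite (bigD1 al) //= eqxx rmorph1 mul1r.
  rewrite big1 ?addr0 => [|be /negPf ->]; last by rewrite rmorph0 mul0r.
  by apply: eq_bigr => i _; rewrite ffunE.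
pose g' := [multinom (g i - (i == j) * q)%N | i < m].
have gE : g = (g' + U_(j) *+ q)%MM.
  apply/mnmP => i; rewrite mnmDE mulmnE mnmE mnm1E [j == i]eq_sym; case: eqP => [->|_].
    by rewrite !mul1n subnK.
  by rewrite !mul0n subn0 addn0.
have mM v b b' : mmap1 v (b + b')%MM = mmap1 v b * mmap1 v b' :> T.
  by apply: commr_mmap1_M => i x; apply: mulrC.
have [|k kP] := @reducible_sum _ (index_enum 'I_m) (B j) (fun l v => mmap1 v (g' + U_(l))%MM).
  move=> l _; apply: IH; move: gd; rewrite gE !mdegD mdegMn !mdeg1 mul1n.
  by move: (mdeg g') q_gt1 => x; lia.
exists k => v vP; rewrite -kP // gE mM.
have -> : mmap1 v (U_(j) *+ q)%MM = v j ^+ q.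
  rewrite /mmap1 (bigD1 j) //= mulmnE mnm1E eqxx mul1n big1 ?mulr1 // => i ij.
  by rewrite mulmnE mnm1E eq_sym (negPf ij) mul0n expr0.
rewrite vP mulr_sumr; apply: eq_bigr => l _; rewrite mM mmap1U; ring.
Qed.

Lemma reducible_mmap (P : {mpoly R[m]}) : reducible (fun v => mmap h v P).
Proof. by apply: reducible_sum => g _; apply: reducible_mnm. Qed.
End Reduction.

(** * Hilbert 90 for the units of the algebra *)

Definition pbool (P : Prop) : bool := if excluded_middle_informative P then true else false.
Lemma pboolP (P : Prop) : reflect P (pbool P).
Proof. by rewrite /pbool; case: excluded_middle_informative => ?; constructor. Qed.

(** Inversion on the lattice of subsets: the elements with [Y] inside [f z] are those with [f z = Y]
    and those with [f z] strictly larger, and the latter are settled by induction from the largest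
    sets down. *)
Lemma card_fiber_eq (T T' S : finType) (N : {set T}) (N' : {set T'})
    (f : T -> {set S}) (f' : T' -> {set S}) :
  (forall Y : {set S}, #|[set z in N | Y \subset f z]| = #|[set z in N' | Y \subset f' z]|) ->
  forall Y : {set S}, #|[set z in N | f z == Y]| = #|[set z in N' | f' z == Y]|.
Proof.
move=> eqN Y; have [d] := ubnP #|~: Y|; elim: d Y => // d IH Y; rewrite ltnS => Yd.
have part (R : finType) (D : {set R}) (h : R -> {set S}) :
    #|[set z in D | Y \subset h z]| =
    (#|[set z in D | h z == Y]| + \sum_(Y' : {set S} | Y \proper Y') #|[set z in D | h z == Y']|)%N.
  transitivity (\sum_(Y' : {set S} | Y \subset Y') #|[set z in D | h z == Y']|)%N.
    rewrite -sum1_card (partition_big h [pred Y' : {set S} | Y \subset Y']) /=; last first.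
      by move=> z; rewrite inE => /andP[].
    apply: eq_bigr => Y' YY'; rewrite -sum1_card; apply: eq_bigl => z; rewrite !inE.
    by case: eqP => [->|]; rewrite ?andbF // YY' !andbT.
  rewrite (bigD1 Y) //=; congr (_ + _)%N; apply: eq_bigl => Y'.
  by rewrite properEneq eq_sym andbC.
have := eqN Y; rewrite !part.
rewrite [X in (_ + X = _)%N -> _](eq_bigr (fun Y' => #|[set z in N' | f' z == Y']|)).
  by move/eqP; rewrite eqn_add2r => /eqP.
move=> Y' YY'; apply: IH; apply: leq_trans Yd; apply: proper_card.
by rewrite properC.
Qed.

(** [M] need not be a domain, but the differences of the given roots are images of nonzero elements
    of [L], hence units, and linear factors can be split off one by one. *)
Lemma poly_zero_many_roots (L : fieldType) (M : comNzRingType) (j : {rmorphism L -> M})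
    (P : {poly M}) (s : seq L) :
  uniq s -> (size P <= size s)%N -> (forall l, l \in s -> P.[j l] = 0) -> P = 0.
Proof.
elim: s P => [|l s IH] P /=; first by rewrite leqn0 size_poly_eq0 => _ /eqP.
case/andP => ls us Ps Pl; have : root P (j l) by apply/rootP/Pl; rewrite mem_head.
case/factor_theorem => Q PE; rewrite PE; suff -> : Q = 0 by rewrite mul0r.
apply: IH => // [|l' l's].
  have [->|Q0] := eqVneq Q 0; first by rewrite size_poly0.
  by move: Ps; rewrite PE size_Mmonic ?monicXsubC // size_XsubC addn2.
have := Pl l'; rewrite inE l's orbT => /(_ isT); rewrite PE hornerM hornerXsubC -rmorphB.
have d0 : l' - l != 0 by rewrite subr_eq0; apply: contraNneq ls => <-.
move/(congr1 ( *%R^~ (j (l' - l)^-1))); rewrite /= mul0r -mulrA -rmorphM mulfV //.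
by rewrite rmorph1 mulr1.
Qed.

Lemma invmx_mulmx (R : comUnitRingType) k (A B : 'M[R]_k) :
  A \in unitmx -> B \in unitmx -> invmx (A *m B) = invmx B *m invmx A.
Proof.
move=> Au Bu; have ABu : A *m B \in unitmx by rewrite unitmx_mul Au.
by rewrite -[RHS](mulKmx ABu) -!mulmxA (mulKVmx Bu) mulmxV // mulmx1.
Qed.

Section Hilbert90.
Variables (F : finFieldType) (n m : nat) (a : 'I_m -> 'M[F]_n).
Hypothesis A1 : inA a 1%:M.
Hypothesis AM : forall g h, inA a g -> inA a h -> inA a (g *m h).
Hypothesis GV : forall g, inG a g -> inG a (invmx g).

Definition unitset : {set 'M[F]_n} := [set g | pbool (inG a g)].
Lemma unitsetP g : reflect (inG a g) (g \in unitset).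
Proof. by rewrite inE; apply: pboolP. Qed.

Lemma unitset1 : 1%:M \in unitset.
Proof. by apply/unitsetP; split; rewrite ?unitmx1. Qed.

Lemma unitsetM g h : g \in unitset -> h \in unitset -> g *m h \in unitset.
Proof.
move=> /unitsetP[gA gu] /unitsetP[hA hu]; apply/unitsetP.
by split; rewrite ?unitmx_mul ?gu //; apply: AM.
Qed.

Lemma unitsetV g : g \in unitset -> invmx g \in unitset.
Proof. by move=> /unitsetP/GV ?; apply/unitsetP. Qed.

Lemma unitset_unit g : g \in unitset -> g \in unitmx.
Proof. by move=> /unitsetP[]. Qed.

Lemma unitset_reindex (V : nmodType) h (f : 'M[F]_n -> V) : h \in unitset ->
  \sum_(g in unitset) f (h *m g) = \sum_(g in unitset) f g.
Proof.
move=> hG; have hu := unitset_unit hG; rewrite [RHS](reindex (mulmx h)) /=.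
  apply: eq_bigl => g; apply/idP/idP => [|hgG]; first exact: unitsetM.
  by rewrite -(mulKmx hu g); apply: unitsetM => //; apply: unitsetV.
by exists (mulmx (invmx h)) => g _; [apply: mulKmx | apply: mulKVmx].
Qed.

Variables (M : comNzRingType) (jM : {rmorphism F -> M}).
Variable sig : 'M[F]_n -> {rmorphism M -> M}.
Hypothesis sig_const : forall g c, g \in unitset -> sig g (jM c) = jM c.
Hypothesis sig1 : forall x, sig 1%:M x = x.
Hypothesis sigM : forall g h x, g \in unitset -> h \in unitset ->
  sig (g *m h) x = sig g (sig h x).

Definition trG (x : M) : M := \sum_(g in unitset) sig g x.

Lemma trG_fixed x h : h \in unitset -> sig h (trG x) = trG x.
Proof.
move=> hG; rewrite rmorph_sum -[RHS](unitset_reindex (fun g => sig g x) hG).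
by apply: eq_bigr => g gG; rewrite sigM.
Qed.

Lemma map_sigM g h (X : 'M[M]_n) : g \in unitset -> h \in unitset ->
  map_mx (sig (g *m h)) X = map_mx (sig g) (map_mx (sig h) X).
Proof. by move=> gG hG; apply/matrixP => i j; rewrite !mxE sigM. Qed.

Lemma map_sig1 (X : 'M[M]_n) : map_mx (sig 1%:M) X = X.
Proof. by apply/matrixP => i j; rewrite !mxE sig1. Qed.

Lemma map_sig_const g (h : 'M[F]_n) : g \in unitset ->
  map_mx (sig g) (map_mx jM h) = map_mx jM h.
Proof. by move=> gG; apply/matrixP => i j; rewrite !mxE sig_const. Qed.

Definition galois_family k (x y : 'I_k -> M) : Prop := forall g, g \in unitset ->
  \sum_i x i * sig g (y i) = (g == 1%:M)%:R.

(* [rho = id] describes the action [w |-> sig g w * g^-1], whose fixed vectors are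
   the solutions sought, and [rho = untwist] the entrywise action; both are needed
   because the finite case compares their fixed vectors. *)
Section Twist.
Variable rho : 'M[F]_n -> 'M[F]_n.
Hypothesis rhoM : forall g h, g \in unitset -> h \in unitset ->
  rho (g *m h) = rho g *m rho h.
Hypothesis rho1 : rho 1%:M = 1%:M.
Hypothesis rho_inA : forall g, g \in unitset -> inA a (rho g).

Definition twisted_fixed (w : 'M[M]_n) : Prop :=
  forall g, g \in unitset -> map_mx (sig g) w = w *m map_mx jM (rho g).

(** The trace of [b *: z] for the action [w |-> sig g w * rho(g)^-1]. *)
Definition twisted_tr (b : M) (z : 'M[M]_n) : 'M[M]_n :=
  \sum_(g in unitset) map_mx (sig g) (b *: z) *m map_mx jM (rho (invmx g)).

Lemma rhoV g : g \in unitset -> rho (invmx g) *m rho g = 1%:M.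
Proof.
by move=> gG; rewrite -rhoM ?unitsetV // mulVmx ?rho1 ?unitset_unit.
Qed.

Lemma twisted_tr_fixed b z : twisted_fixed (twisted_tr b z).
Proof.
move=> h hG; rewrite map_mx_sum mulmx_suml.
rewrite -(unitset_reindex (fun g => map_mx (sig g) (b *: z) *m map_mx jM (rho (invmx g))
  *m map_mx jM (rho h)) hG); apply: eq_bigr => g gG.
rewrite map_mxM map_sig_const // map_sigM // -mulmxA -map_mxM; congr (_ *m map_mx _ _).
have [gu hu] := (unitset_unit gG, unitset_unit hG).
by rewrite invmx_mulmx // rhoM ?unitsetV // -mulmxA rhoV // mulmx1.
Qed.

(** Summing over [i] first, the Galois coordinates kill every term of the traces except the one for
    [g = 1]. Hence fixed vectors span all matrices over [M]. *)
Lemma twisted_tr_dual k (x y : 'I_k -> M) z : galois_family x y ->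
  z = \sum_i x i *: twisted_tr (y i) z.
Proof.
move=> xy; rewrite (eq_bigr (fun i => \sum_(g in unitset)
   (x i * sig g (y i)) *: (map_mx (sig g) z *m map_mx jM (rho (invmx g))))); last first.
  move=> i _; rewrite scaler_sumr; apply: eq_bigr => g _.
  by rewrite map_mxZ -scalemxAl scalerA.
rewrite exchange_big /= (bigD1 1%:M) ?unitset1 //= -scaler_suml xy ?unitset1 // eqxx scale1r.
have -> : invmx 1%:M = 1%:M :> 'M[F]_n by rewrite invmx1.
rewrite map_sig1 rho1 map_mx1 mulmx1 big1 ?addr0 // => g /andP[gG g1].
by rewrite -scaler_suml xy // (negPf g1) scale0r.
Qed.

Lemma twisted_tr_inAT b z : inAT a jM z -> inAT a jM (twisted_tr b z).
Proof.
move=> zA; apply: inAT_sum => g gG; apply: (inATM AM); last first.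
  by apply/inAT_inA/rho_inA/unitsetV.
have := inAT_map (sig g) (inATZ b zA); apply: inAT_eq => c /=.
exact: sig_const.
Qed.

Lemma twisted_tr_comb k (x : 'I_k -> M) (z : 'I_k -> 'M[M]_n) b :
  (forall i, twisted_fixed (z i)) ->
  twisted_tr b (\sum_i x i *: z i) = \sum_i trG (b * x i) *: z i.
Proof.
move=> zfix; rewrite [RHS](eq_bigr (fun i => \sum_(g in unitset) sig g (b * x i) *: z i)).
  rewrite [RHS]exchange_big; apply: eq_bigr => g gG /=.
  rewrite scaler_sumr map_mx_sum mulmx_suml; apply: eq_bigr => i _.
  rewrite scalerA map_mxZ zfix // -scalemxAl -mulmxA -map_mxM.
  by rewrite -rhoM ?unitsetV // mulmxV ?unitset_unit // rho1 map_mx1 mulmx1.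
by move=> i _; rewrite -scaler_suml.
Qed.
End Twist.

Definition untwist (g : 'M[F]_n) : 'M[F]_n := 1%:M.
Local Notation fixed := (twisted_fixed untwist).

Lemma fixedE w : fixed w <-> forall g, g \in unitset -> map_mx (sig g) w = w.
Proof. by split=> wf g gG; have := wf g gG; rewrite map_mx1 mulmx1. Qed.

Lemma mul_twisted_tr rho b (Y z : 'M[M]_n) : fixed Y -> Y *m z = 0 ->
  Y *m twisted_tr rho b z = 0.
Proof.
move=> /fixedE Yfix Yz; rewrite mulmx_sumr big1 // => g gG.
by rewrite mulmxA -{1}(Yfix _ gG) -map_mxM -scalemxAr Yz scaler0 map_mx0 mul0mx.
Qed.

Section DualFamily.
Variables (L : fieldType) (jL : {rmorphism L -> M}).
Hypothesis sig_L : forall g l, g \in unitset -> sig g (jL l) = jL l.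
Hypothesis fixed_L : forall x, (forall g, g \in unitset -> sig g x = x) -> exists l, x = jL l.

(* An [L]-linear relation between the [x i] allows one to shorten the family, so a
   shortest family is a basis together with its trace-dual basis. *)
Lemma galois_family_dual k (x y : 'I_k -> M) : galois_family x y ->
  exists k' (x' y' : 'I_k' -> M), galois_family x' y' /\
    forall i j, trG (y' i * x' j) = (i == j)%:R.
Proof.
elim: k x y => [|k IH] x y xy.
  by exists 0, x, y; split=> // -[].
have [x_free|] := classic (forall c : 'I_k.+1 -> L, \sum_i jL (c i) * x i = 0 -> forall i, c i = 0).
  exists k.+1, x, y; split=> // i j.
  have /fin_all_exists[t tP] : forall i, exists l, trG (y i * x j) = jL l.
    by move=> i'; apply: fixed_L => g gG; apply: trG_fixed.
  have := x_free (fun i => t i - (i == j)%:R) _ i.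
  rewrite tP => xfi; suff /eqP : t i - (i == j)%:R = 0.
    by rewrite subr_eq0 => /eqP ->; rewrite rmorph_nat.
  apply: xfi; rewrite (eq_bigr (fun i => jL (t i) * x i - (i == j)%:R * x i)); last first.
    by move=> i' _; rewrite rmorphB rmorph_nat mulrBl.
  rewrite sumrB [X in _ - X](bigD1 j) //= eqxx mul1r [X in _ - (_ + X)]big1 ?addr0.
    apply/eqP; rewrite subr_eq0; apply/eqP.
    transitivity (\sum_(g in unitset) (g == 1%:M)%:R * sig g (x j)).
      rewrite (eq_bigr (fun i => \sum_(g in unitset) x i * sig g (y i) * sig g (x j))).
        by rewrite exchange_big; apply: eq_bigr => g gG; rewrite -mulr_suml xy.
      move=> i' _; rewrite -tP mulrC mulr_sumr; apply: eq_bigr => g gG.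
      by rewrite rmorphM mulrA.
    rewrite (bigD1 1%:M) ?unitset1 //= eqxx mul1r sig1 big1 ?addr0 // => g /andP[_ /negPf ->].
    by rewrite mul0r.
  by move=> i' /negPf ->; rewrite mul0r.
move=> nfree; have [c [cx [i0 ci0]]] : exists c : 'I_k.+1 -> L,
    \sum_i jL (c i) * x i = 0 /\ exists i0, c i0 != 0.
  apply: NNPP => nex; apply: nfree => c cx i; apply/eqP/contraT => ci.
  by case: nex; exists c; split=> //; exists i.
(* The relation expresses [x i0] through the other [x i], and [y i0] is distributed over the other
   [y i] accordingly. *)
pose d i := c (lift i0 i) / c i0.
apply: (IH (fun i => x (lift i0 i)) (fun i => y (lift i0 i) - jL (d i) * y i0)) => g gG.
rewrite -xy // [RHS](bigD1_ord i0) //=.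
have -> : x i0 = - \sum_i jL (d i) * x (lift i0 i).
  apply/eqP; rewrite -addr_eq0; apply/eqP.
  have := congr1 ( *%R (jL (c i0)^-1)) cx; rewrite mulr0 (bigD1_ord i0) //= mulrDr.
  rewrite mulrA -rmorphM mulVf // rmorph1 mul1r mulr_sumr => cx'; rewrite -[RHS]cx'.
  by congr (_ + _); apply: eq_bigr => i _; rewrite mulrA -rmorphM [(c i0)^-1 * _]mulrC.
rewrite mulNr mulr_suml addrC -sumrB; apply: eq_bigr => i _.
by rewrite rmorphB rmorphM sig_L //; ring.
Qed.

(** For a twisted fixed [V], [det V] is multiplied by [det g] under [sig g]; the power [q - 1]
    removes this factor of [F] and lands in the field [L], where being nonzero suffices. The
    adjugate then gives the inverse. *)
Lemma inverse_of_det_pow (V : 'M[M]_n) l : l != 0 -> \det V ^+ #|F|.-1 = jL l ->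
  exists W, V *m W = 1%:M.
Proof.
move=> l0 Vl; have q1 : (0 < #|F|.-1)%N by have := cardF_gt1 F; case: #|F| => [|[]].
exists ((jL l^-1 * \det V ^+ #|F|.-2) *: \adj V).
rewrite -scalemxAr mul_mx_adj scale_scalar_mx -mulrA -exprSr prednK // Vl.
by rewrite -rmorphM mulVf // rmorph1.
Qed.

(* [det (\sum_i la i *: W i) ^ (q - 1)] is [1] at [la = x], and lies in [L] when
   [la] does; the coordinates of [x] are replaced by elements of [L] one at a time,
   each time keeping a polynomial in one variable nonzero. *)
Lemma hilbert90_infinite k (x y : 'I_k -> M) : galois_family x y ->
  ~ (exists s : seq L, forall l, l \in s) ->
  exists V W, [/\ inAT a jM V, V *m W = 1%:M & twisted_fixed id V].
Proof.
move=> xy Linf.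
have many N : exists s : seq L, uniq s /\ size s = N.
  elim: N => [|N [s [us sN]]]; first by exists [::].
  suff [l ls] : exists l, l \notin s by exists (l :: s); rewrite /= ls us sN.
  apply: NNPP => nl; apply: Linf; exists s => l; apply/contraT => ls.
  by case: nl; exists l.
pose W i := twisted_tr id (y i) 1%:M.
have Wfix i : twisted_fixed id (W i) by apply: twisted_tr_fixed.
have WA i : inAT a jM (W i).
  by apply: twisted_tr_inAT => [g /unitsetP[]|] //; apply: inAT1.
pose D (la : 'I_k -> M) := \det (\sum_i la i *: W i) ^+ #|F|.-1.
pose mix j (l : 'I_k -> L) (i : 'I_k) := if (i < j)%N then jL (l i) else x i.
have step j : (j <= k)%N -> exists l, D (mix j l) != 0.
  elim: j => [|j IH] jk.
    exists (fun=> 0); rewrite /D (eq_bigr (fun i => x i *: W i)) //.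
    by rewrite -(twisted_tr_dual (rho := id)) // det1 expr1n oner_neq0.
  have [l Dl] := IH (ltnW jk); pose j0 := Ordinal jk.
  pose B := \sum_(i | i != j0) mix j l i *: W i.
  pose P := \det (map_mx polyC B + 'X *: map_mx polyC (W j0)) ^+ #|F|.-1.
  have PE c : P.[c] = \det (B + c *: W j0) ^+ #|F|.-1.
    rewrite /P horner_exp -horner_evalE -det_map_mx map_mxD map_mxZ /= horner_evalE hornerX.
    by rewrite -!map_mx_comp; congr (\det (_ + _ *: _) ^+ _);
      apply/matrixP => r s; rewrite !mxE /= horner_evalE hornerC.
  have P0 : P != 0.
    apply: contraNneq Dl => P0; have := PE (x j0); rewrite P0 horner0 => ->.
    rewrite /D (bigD1 j0) //= addrC /B; apply/eqP; congr (\det (_ + _ *: _) ^+ _).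
    by rewrite /mix ltnn.
  have [s [us sP]] := many (size P).
  have [l0 Pl0] : exists l0, P.[jL l0] != 0.
    apply: NNPP => nl0; case/eqP: P0; apply: (poly_zero_many_roots (j := jL) us).
      by rewrite sP.
    by move=> l0 _; apply/eqP/contraT => Pl0; case: nl0; exists l0.
  exists (fun i => if i == j0 then l0 else l i).
  rewrite PE in Pl0; rewrite /D (bigD1 j0) //= addrC.
  rewrite /mix ltnSn eqxx (eq_bigr (fun i => mix j l i *: W i)) // => i ij0.
  rewrite (negPf ij0) /mix ltnS leq_eqVlt.
  by have -> : (i == j :> nat) = false by apply/negbTE.
have [l Dl] := step k (leqnn k); pose V := \sum_i jL (l i) *: W i.
have VD : D (mix k l) = \det V ^+ #|F|.-1.
  by congr (\det _ ^+ _); apply: eq_bigr => i _; rewrite /mix ltn_ord.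
have Vfix : twisted_fixed id V.
  move=> g gG; rewrite map_mx_sum mulmx_suml; apply: eq_bigr => i _.
  by rewrite map_mxZ sig_L // Wfix // -scalemxAl.
have [d Vd] : exists d, \det V ^+ #|F|.-1 = jL d.
  apply: fixed_L => g gG; rewrite rmorphXn /= -det_map_mx Vfix // det_mulmx exprMn.
  rewrite det_map_mx -rmorphXn /=; have := unitset_unit gG; rewrite unitmxE unitfE => dg.
  suff -> : \det g ^+ #|F|.-1 = 1 by rewrite rmorph1 mulr1.
  by apply: (mulfI dg); rewrite mulr1 -exprS prednK ?expf_card // (ltnW (cardF_gt1 F)).
have d0 : d != 0 by apply: contraNneq Dl => d0; rewrite VD Vd d0 rmorph0.
have [V' VV'] := inverse_of_det_pow d0 Vd; exists V, V'; split=> //.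
by apply: inAT_sum => i _; apply: inATZ.
Qed.
End DualFamily.
End Hilbert90.

Section Hilbert90Finite.
Variables (F : finFieldType) (n m : nat) (a : 'I_m -> 'M[F]_n).
Hypothesis A1 : inA a 1%:M.
Hypothesis AM : forall g h, inA a g -> inA a h -> inA a (g *m h).
Hypothesis GV : forall g, inG a g -> inG a (invmx g).
Variables (M : finComNzRingType) (jM : {rmorphism F -> M}).
Variable sig : 'M[F]_n -> {rmorphism M -> M}.
Hypothesis sig_const : forall g c, g \in unitset a -> sig g (jM c) = jM c.
Hypothesis sig1 : forall x, sig 1%:M x = x.
Hypothesis sigM : forall g h x, g \in unitset a -> h \in unitset a ->
  sig (g *m h) x = sig g (sig h x).
Variables (k : nat) (x y : 'I_k -> M).
Hypothesis xy : galois_family a sig x y.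
Hypothesis xy_dual : forall i j, trG a sig (y i * x j) = (i == j)%:R.

Definition fixed_set rho : {set 'M[M]_n} :=
  [set z | pbool (inAT a jM z /\ twisted_fixed a jM sig rho z)].

Lemma fixed_setP rho z :
  reflect (inAT a jM z /\ twisted_fixed a jM sig rho z) (z \in fixed_set rho).
Proof. by rewrite inE; apply: pboolP. Qed.

Definition annihilator (w : 'M[M]_n) : {set 'M[M]_n} :=
  [set Y in fixed_set (@untwist F n) | Y *m w == 0].

Lemma galois_family_gt0 : (0 < k)%N.
Proof.
case: (posnP k) => // k0; have /eqP := xy (unitset1 A1).
rewrite eqxx big1 => [|i]; last by have := ltn_ord i; rewrite {2}k0.
by rewrite eq_sym oner_eq0.
Qed.

(* Galois descent: a submodule of the matrices over [M] stable under the twisted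
   action is spanned by its fixed vectors, [x] being a basis of [M]. *)
Lemma card_annihilated rho (Ys : {set 'M[M]_n}) :
  (forall g h, g \in unitset a -> h \in unitset a -> rho (g *m h) = rho g *m rho h) ->
  rho 1%:M = 1%:M -> (forall g, g \in unitset a -> inA a (rho g)) ->
  Ys \subset fixed_set (@untwist F n) ->
  (#|[set z in fixed_set rho | Ys \subset annihilator z]| ^ k)%N =
  #|[set z : 'M[M]_n | pbool (inAT a jM z) & [forall (Y | Y \in Ys), Y *m z == 0]]|.
Proof.
move=> rhoM rho1 rhoA Yfix; set D := [set z in _ | _].
pose phi (f : {ffun 'I_k -> 'M[M]_n}) := \sum_i x i *: f i.
rewrite -[X in (_ ^ X)%N]card_ord -card_ffun_on -(@card_in_imset _ _ phi).
  apply: eq_card => z; rewrite inE; apply/imsetP/andP => [[f /ffun_onP fD ->]|].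
    split; first apply/pboolP.
      apply: inAT_sum => i _; apply: inATZ.
      by have := fD i; rewrite inE => /andP[/fixed_setP[]].
    apply/forall_inP => Y YY; rewrite mulmx_sumr big1 // => i _.
    have := fD i; rewrite inE => /andP[_ /subsetP/(_ Y YY)].
    by rewrite inE -scalemxAr => /andP[_ /eqP ->]; rewrite scaler0.
  move=> [/pboolP zA /forall_inP Yz].
  exists [ffun i => twisted_tr a jM sig rho (y i) z]; last first.
    rewrite {1}(twisted_tr_dual A1 jM sig1 rho1 z xy).
    by apply: eq_bigr => i _; rewrite ffunE.
  apply/ffun_onP => i; rewrite ffunE inE; apply/andP; split.
    apply/fixed_setP; split; first exact: twisted_tr_inAT.
    exact: twisted_tr_fixed.
  apply/subsetP => Y YY; have YL := subsetP Yfix _ YY; rewrite inE YL /=.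
  have /fixed_setP[_ Yf] := YL.
  by apply/eqP; apply: mul_twisted_tr => //; apply/eqP/Yz.
move=> f f' /ffun_onP fD /ffun_onP fD' ff'; apply/ffunP => i.
have fE (h : {ffun 'I_k -> 'M[M]_n}) : (forall i, h i \in D) ->
    h i = twisted_tr a jM sig rho (y i) (phi h).
  move=> hD; rewrite (twisted_tr_comb GV rhoM rho1); last first.
    by move=> j; have := hD j; rewrite inE => /andP[/fixed_setP[]].
  rewrite (bigD1 i) //= xy_dual eqxx scale1r big1 ?addr0 // => j ji.
  by rewrite xy_dual eq_sym (negPf ji) scale0r.
by rewrite (fE f fD) (fE f' fD') ff'.
Qed.

(* Counting elements by their annihilators: by descent, the twisted and untwisted
   fixed spaces contain equally many elements killed by any given [Ys], hence
   equally many elements with any given annihilator. *)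
Lemma hilbert90_finite :
  exists V W, [/\ inAT a jM V, V *m W = 1%:M & twisted_fixed a jM sig id V].
Proof.
have uM g h : g \in unitset a -> h \in unitset a ->
    untwist (g *m h) = untwist g *m untwist h by rewrite mulmx1.
have uA g : g \in unitset a -> inA a (untwist g) by [].
have idA g : g \in unitset a -> inA a g by move=> /unitsetP[].
have annS w : annihilator w \subset fixed_set (@untwist F n).
  by apply/subsetP => Y; rewrite inE => /andP[].
have fib (Ys : {set 'M[M]_n}) : #|[set z in fixed_set (@untwist F n) | Ys \subset annihilator z]| =
              #|[set z in fixed_set id | Ys \subset annihilator z]|.
  have [YL|YL] := boolP (Ys \subset fixed_set (@untwist F n)).
    (* The [k]-th powers of both sides count the same matrices, in a description free of [rho]. *)
    by apply/eqP; rewrite -(eqn_exp2r _ _ galois_family_gt0) !card_annihilated.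
  rewrite !eq_card0 // => z; rewrite inE; apply/andP => -[_ /subset_trans/(_ (annS z))];
  by apply/negP.
have zero_fixed : (0 : 'M[M]_n) \in fixed_set (@untwist F n).
  apply/fixed_setP; split; first exact: inAT0.
  by move=> g gG; rewrite map_mx0 mul0mx.
have one_fixed : (1%:M : 'M[M]_n) \in fixed_set (@untwist F n).
  apply/fixed_setP; split; first exact: inAT1.
  by move=> g gG; rewrite !map_mx1 mulmx1.
have ann1 : annihilator 1%:M = [set 0].
  apply/setP => Y; rewrite !inE mulmx1; apply/andP/eqP => [[_ /eqP] //|->].
  by rewrite eqxx; split=> //; move: zero_fixed; rewrite inE.
(* The identity is an untwisted fixed vector with zero annihilator, so a twisted one exists as
   well. *)
have : (0 < #|[set z in fixed_set id | annihilator z == [set 0%R]]|)%N.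
  rewrite -(card_fiber_eq fib) card_gt0; apply/set0Pn; exists 1%:M.
  by rewrite inE one_fixed ann1 eqxx.
rewrite card_gt0 => /set0Pn[V]; rewrite inE => /andP[/fixed_setP[VA Vfix] /eqP annV].
have cancelV z : inAT a jM z -> z *m V = 0 -> z = 0.
  move=> zA zV; rewrite (twisted_tr_dual A1 jM sig1 (erefl : untwist 1%:M = 1%:M) z xy).
  rewrite big1 // => i _; set t := twisted_tr _ _ _ _ _ _.
  suff : t \in annihilator V by rewrite annV inE => /eqP ->; rewrite scaler0.
  rewrite inE; apply/andP; split.
    apply/fixed_setP; split; first exact: twisted_tr_inAT.
    exact: twisted_tr_fixed.
  rewrite /t /twisted_tr mulmx_suml; apply/eqP/big1 => g gG.
  have gu := unitset_unit gG.
  have -> : V = map_mx (sig g) V *m map_mx jM (invmx g).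
    by rewrite Vfix // -mulmxA -map_mxM mulmxV // map_mx1 mulmx1.
  by rewrite map_mx1 mulmx1 mulmxA -map_mxM -scalemxAl zV scaler0 map_mx0 mul0mx.
pose AM_set := [set z : 'M[M]_n | pbool (inAT a jM z)].
(* Right multiplication by [V] is injective on the finite algebra over [M], hence onto, and reaches
   the identity. *)
have imV : [set z *m V | z in AM_set] = AM_set.
  apply/eqP; rewrite eqEcard; apply/andP; split.
    apply/subsetP => _ /imsetP[z + ->]; rewrite !inE => /pboolP zA.
    by apply/pboolP/inATM.
  rewrite card_in_imset // => z z'; rewrite !inE => /pboolP zA /pboolP zA' zz'.
  apply/eqP; rewrite -subr_eq0 -scaleN1r; apply/eqP/cancelV.
    by apply: inATD => //; apply: inATZ.
  by rewrite mulmxDl zz' -scalemxAl scaleN1r subrr.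
have : (1%:M : 'M[M]_n) \in AM_set by rewrite inE; apply/pboolP/inAT1.
rewrite -imV => /imsetP[W _ /esym VW]; exists V, W; split=> //.
exact: mulmx1C.
Qed.
End Hilbert90Finite.

(* A field is either finite, in which case so is [M] and one can count, or
   infinite, in which case the determinant of a generic fixed vector does not
   vanish at some point. *)
Lemma hilbert90 (F : finFieldType) (n m : nat) (a : 'I_m -> 'M[F]_n) :
  inA a 1%:M -> (forall g h, inA a g -> inA a h -> inA a (g *m h)) ->
  (forall g, inG a g -> inG a (invmx g)) ->
  forall (M : comNzRingType) (jM : {rmorphism F -> M}) (sig : 'M[F]_n -> {rmorphism M -> M}),
  (forall g c, g \in unitset a -> sig g (jM c) = jM c) ->
  (forall x, sig 1%:M x = x) ->
  (forall g h x, g \in unitset a -> h \in unitset a -> sig (g *m h) x = sig g (sig h x)) ->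
  forall (L : fieldType) (jL : {rmorphism L -> M}),
  (forall g l, g \in unitset a -> sig g (jL l) = jL l) ->
  (forall x, (forall g, g \in unitset a -> sig g x = x) -> exists l, x = jL l) ->
  forall k (x y : 'I_k -> M), galois_family a sig x y ->
  exists V W, [/\ inAT a jM V, V *m W = 1%:M & twisted_fixed a jM sig id V].
Proof.
move=> A1 AM GV M jM sig sig_const sig1 sigM L jL sig_L fixed_L k x y xy.
have [[s sP]|Linf] := classic (exists s : seq L, forall l, l \in s); last first.
  exact: (hilbert90_infinite A1 AM GV sig_const sig1 sigM sig_L fixed_L xy Linf).
have {k x y xy} [k [x [y [xy xy_dual]]]] :=
  galois_family_dual A1 AM GV sig1 sigM sig_L fixed_L xy.
(* By trace duality every element of [M] is a combination of the [x i] over the finite field [L];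
   this list exhausts [M] and gives it a finite type structure. *)
pose e := [seq \sum_i jL (val (f i)) * x i | f : {ffun 'I_k -> seq_sub s}].
have eP z : z \in e.
  have /fin_all_exists[l lP] : forall i, exists l, trG a sig (y i * z) = jL l.
    by move=> i; apply: fixed_L => g gG; apply: trG_fixed.
  apply/mapP; exists [ffun i => SeqSub (sP (l i))]; first by rewrite mem_enum.
  transitivity (\sum_(g in unitset a) (g == 1%:M)%:R * sig g z).
    rewrite (bigD1 1%:M) ?unitset1 //= eqxx mul1r sig1 big1 ?addr0 //.
    by move=> g /andP[_ /negPf ->]; rewrite mul0r.
  rewrite (eq_bigr (fun g => \sum_i x i * sig g (y i) * sig g z)); last first.
    by move=> g gG; rewrite -mulr_suml xy.
  rewrite exchange_big; apply: eq_bigr => i _ /=; rewrite ffunE /= -lP mulrC mulr_sumr.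
  by apply: eq_bigr => g _; rewrite rmorphM mulrA.
pose r (z : M) := index z (undup e); pose r' i := nth 0 (undup e) i.
have rK : cancel r r' by move=> z; rewrite /r' nth_index // mem_undup.
have ax : Finite.axiom (undup e) by move=> z; rewrite count_uniq_mem ?undup_uniq // mem_undup eP.
pose Mc := CanIsCountable rK.
pose Mf := isFinite.Build M ax.
pose M' : finComNzRingType := HB.pack M Mc Mf.
exact: (@hilbert90_finite F n m a A1 AM GV M' jM sig sig_const sig1 sigM k x y xy xy_dual).
Qed.

(** * The Galois group of E/K *)

Section Lang.
Variables (F : finFieldType) (n m : nat) (a : 'I_m -> 'M[F]_n).
Variable kappa : 'I_m -> 'M[F]_n.
Hypothesis kappaP : forall i j, \sum_r \sum_s kappa i r s * a j r s = (i == j)%:R.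
Hypothesis A1 : inA a 1%:M.
Hypothesis AM : forall g h, inA a g -> inA a h -> inA a (g *m h).
Variables (E : fieldType) (iota : {rmorphism Kfield F m -> E}).
Local Notation acoord := (acoord kappa).

Definition polE : {rmorphism Pol F m -> E} := iota \o @FracField.tofrac (Pol F m).
Definition constE : {rmorphism F -> E} := polE \o @mpolyC m F.
Definition tE (i : 'I_m) : E := polE 'X_i.

Lemma polE_mmap : polE =1 mmap constE tE.
Proof. by apply: mmap_unique. Qed.

Lemma polE_eq0 p : (polE p == 0) = (p == 0).
Proof. by rewrite fmorph_eq0 tofrac_eq0. Qed.

Lemma map_AK : map_mx iota (AK a) = elt a constE tE.
Proof.
rewrite -map_Apoly -map_mx_comp.
by apply: eq_map_mx => p; rewrite -polE_mmap.
Qed.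

Lemma iota_frac x : exists p q, q != 0 /\ iota x = polE p / polE q.
Proof.
have [p [q [q0 ->]]] := fracP x; exists p, q; split=> //.
by rewrite rmorphM fmorphV.
Qed.

Definition frobE : {rmorphism E -> E} :=
  sval (constructive_indefinite_description _ (qpow_rmorphism constE 1)).

Lemma frobEE x : frobE x = x ^+ #|F|.
Proof.
by rewrite /frobE; case: constructive_indefinite_description => /= f ->; rewrite /qpow expn1.
Qed.

Lemma frobE_const c : frobE (constE c) = constE c.
Proof. by rewrite frobEE -rmorphXn expf_card. Qed.

Lemma frobq_map (V : 'M[E]_n) : frobq F V = map_mx frobE V.
Proof. by apply: eq_map_mx => x; rewrite frobEE. Qed.

Definition is_solution (V : 'M[E]_n) : Prop :=
  [/\ inAT a constE V, V \in unitmx & elt a constE tE *m frobq F V = V].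

Lemma det_solution_neq0 V : is_solution V -> \det V != 0.
Proof. by case=> _ Vu _; rewrite -unitfE -unitmxE. Qed.

(* The coordinates of [V (V^(q))^-1] are polynomials in those of [V], divided by
   [det V ^ q]. *)
Lemma lang_poly : exists Ps : 'I_m -> Pol F m,
  forall (T : comNzRingType) (h : {rmorphism F -> T}) (v t : 'I_m -> T),
    elt a h t *m map_mx (fun x => x ^+ #|F|) (elt a h v) = elt a h v ->
  forall i, t i * \det (elt a h v) ^+ #|F| = mmap h v (Ps i).
Proof.
have [fP fPE] := qpow_rmorphism (@mpolyC m F) 1; pose Pq := map_mx fP (Apoly a).
exists (fun i => acoord (@mpolyC m F) i (Apoly a *m \adj Pq)) => T h v t VE i.
have [fT fTE] := qpow_rmorphism h 1.
set V := elt a h v in VE *; set Vq := map_mx _ V in VE.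
have VqE : Vq = map_mx fT V by apply: eq_map_mx => x; rewrite fTE /qpow expn1.
have PqE : map_mx (mmap h v) Pq = Vq.
  rewrite -map_mx_comp /Vq /V -map_Apoly -map_mx_comp.
  by apply: eq_map_mx => x /=; rewrite fPE /qpow expn1 rmorphXn.
rewrite -(acoord_map kappa (mpolyC m (R:=F)) (mmap h v)) map_mxM map_mx_adj PqE.
rewrite map_Apoly -/V -[in RHS]VE -mulmxA mul_mx_adj mul_mx_scalar.
rewrite (acoord_eq kappa (h' := h)); last by move=> c /=; rewrite mmapC.
rewrite linearZ /= acoord_elt // [LHS]mulrC; congr (_ * _).
by rewrite VqE det_map_mx fTE /qpow expn1.
Qed.

Lemma tE_poly : exists Ps : 'I_m -> Pol F m, forall V, is_solution V -> forall i,
  tE i * \det V ^+ #|F| = mmap constE (acoord constE ^~ V) (Ps i).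
Proof.
have [Ps PsP] := lang_poly; exists Ps => V [VA _ VE] i.
by rewrite -(PsP _ _ _ tE) elt_acoord.
Qed.

(** The [t i] are fractions in the coordinates of [V], with common denominator [det V^q]; a relation
    between the coordinates would transfer to the indeterminates. *)
Lemma solution_indep V : is_solution V -> alg_independent constE (acoord constE ^~ V).
Proof.
move=> Vsol Q Qu; apply/eqP/negP => /negP Q0; have [Ps PsP] := tE_poly.
have [VA _ _] := Vsol.
have du : mmap constE (acoord constE ^~ V) (dpoly a ^+ #|F|) = \det V ^+ #|F|.
  by rewrite rmorphXn /= mmap_dpoly elt_acoord.
have := @alg_dependent_transfer _ _ _ constE _ Q Q0 Qu tE (dpoly a ^+ #|F|) Ps.
rewrite du expf_neq0 ?det_solution_neq0 // => /(_ isT)[i|p p0]; first exact: PsP.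
by move/eqP; apply/negP; rewrite -polE_mmap polE_eq0.
Qed.

Lemma solution_mul V g : is_solution V -> inG a g -> is_solution (V *m map_mx constE g).
Proof.
move=> [VA Vu VE] [gA gu]; split.
- by apply: (inATM AM) => //; apply: inAT_inA.
- by rewrite unitmx_mul Vu map_unitmx.
- rewrite frobq_map map_mxM mulmxA -frobq_map VE -map_mx_comp; congr (_ *m _).
  by apply: eq_map_mx => c /=; rewrite frobE_const.
Qed.

(** From [A V^(q) = V] and [A W^(q) = W], the quotient [V^-1 W] is fixed by Frobenius, so its
    coordinates lie in [F]. *)
Lemma solution_quotient V W : is_solution V -> is_solution W ->
  exists2 g, inG a g & W = V *m map_mx constE g.
Proof.
move=> [VA Vu VE] [WA Wu WE]; pose G := invmx V *m W.
have VG : V *m G = W by rewrite mulmxA mulmxV ?mul1mx.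
have GA : inAT a constE G.
  by apply: (inATM AM) => //; apply: (inAT_inv A1 AM VA); rewrite mulmxV.
have Gq : map_mx frobE G = G.
  rewrite -[LHS]mul1mx -(mulVmx Vu) -{2}VE -!mulmxA frobq_map -map_mxM VG.
  by rewrite -frobq_map WE.
have : forall i, exists d, acoord constE i G = constE d.
  move=> i; apply: (qpow_fixed constE); rewrite -frobEE -(acoord_map kappa).
  by rewrite Gq; apply: acoord_eq => c /=; rewrite frobE_const.
case/fin_all_exists => d dP; pose g := \sum_i d i *: a i.
have gG : map_mx constE g = G.
  rewrite -(elt_acoord kappaP GA) map_mx_sum; apply: eq_bigr => i _.
  by rewrite map_mxZ dP.
exists g; last by rewrite gG.
split; first by exists d.
by rewrite -(map_unitmx constE) gG unitmx_mul unitmx_inv Vu.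
Qed.

Lemma inG1 : inG a 1%:M. Proof. by split; rewrite ?unitmx1. Qed.

Lemma inGM g h : inG a g -> inG a h -> inG a (g *m h).
Proof. by move=> [gA gu] [hA hu]; split; rewrite ?unitmx_mul ?gu //; apply: AM. Qed.

Lemma inGV g : inG a g -> inG a (invmx g).
Proof.
move=> [gA gu]; split; last by rewrite unitmx_inv.
have idA h : inA a h <-> inAT a (idfun : {rmorphism F -> F}) h.
  by split=> -[c ->]; exists c; apply: eq_bigr => i _; rewrite map_mx_id.
by apply/idA; apply: (inAT_inv A1 AM) (mulmxV gu) => //; apply/idA.
Qed.

Section Solution.
Variable U : 'M[E]_n.
Hypothesis U_sol : is_solution U.
Hypothesis U_gen : generated_by_U iota U.
Local Notation u := (acoord constE ^~ U).

Lemma Kaut_ext (s s' : {rmorphism E -> E}) :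
  (forall k, s (iota k) = iota k) -> (forall k, s' (iota k) = iota k) ->
  map_mx s U = map_mx s' U -> s =1 s'.
Proof.
move=> sK s'K sU; apply: U_gen => [|k|i j].
- split=> [|x y sx sy|x y sx sy|x sx]; first by rewrite !rmorph1.
  + by rewrite !rmorphB sx sy.
  + by rewrite !rmorphM sx sy.
  + by rewrite !fmorphV sx.
- by rewrite sK s'K.
- by have /matrixP/(_ i j) := sU; rewrite !mxE.
Qed.

Lemma det_tu : (\det U) ^+ #|F| * polE (dpoly a) = \det U.
Proof.
case: U_sol => UA Uu UE; rewrite polE_mmap mmap_dpoly -{2}UE det_mulmx mulrC.
by rewrite frobq_map det_map_mx frobEE.
Qed.


Definition det_power (Q : Pol F m) : Prop := exists k, Q = dpoly a ^+ k.

Lemma det_power1 : det_power 1. Proof. by exists 0; rewrite expr0. Qed.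

Lemma det_powerM P Q : det_power P -> det_power Q -> det_power (P * Q).
Proof. by move=> [k ->] [l ->]; exists (k + l)%N; rewrite exprD. Qed.

Lemma mmap_u_dpoly : mmap constE u (dpoly a) = \det U.
Proof. by case: U_sol => UA _ _; rewrite mmap_dpoly elt_acoord. Qed.

Lemma det_power_neq0 Q : det_power Q -> Q != 0.
Proof.
move=> [k ->]; apply: expf_neq0; apply: contraNneq (det_solution_neq0 U_sol) => d0.
by rewrite -mmap_u_dpoly d0 raddf0.
Qed.

Lemma polE_frac p : is_frac constE u det_power (polE p).
Proof.
have [Ps PsP] := tE_poly; rewrite polE_mmap.
apply: (@mmap_closed _ _ _ constE tE (is_frac constE u det_power)) => [y z|y z|c|i].
- exact: (is_fracD det_powerM).
- exact: (is_fracM det_powerM).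
- exact: (is_frac_const _ _ det_power1).
- exists (Ps i), (dpoly a ^+ #|F|); split; first by exists #|F|.
  by rewrite rmorphXn /= mmap_u_dpoly -PsP.
Qed.

Lemma U_poly i j : U i j = mmap constE u (Apoly a i j).
Proof.
case: U_sol => UA _ _; rewrite -{1}(elt_acoord kappaP UA) -map_Apoly.
by rewrite mxE.
Qed.

Lemma frac_u x : is_frac constE u (fun Q => Q != 0) x.
Proof.
have indep := solution_indep U_sol.
pose P y := is_frac constE u (fun Q => Q != 0) y.
have P1 : (1 : Pol F m) != 0 by apply: oner_neq0.
have D0 (A B : Pol F m) : A != 0 -> B != 0 -> A * B != 0 by apply: mulf_neq0.
have PD y z : P y -> P z -> P (y + z) by apply: is_fracD.
have PM y z : P y -> P z -> P (y * z) by apply: is_fracM.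
have Pc c : P (constE c) by apply: is_frac_const.
have PV y : P y -> P y^-1.
  have [->|y0] := eqVneq y 0; first by rewrite invr0.
  move=> [A [B [B0 yB]]]; exists B, A; rewrite -yB mulKf //; split=> //.
  apply: contraNneq y0 => A0; move/eqP: yB; rewrite A0 raddf0 mulf_eq0.
  by case/orP => // /eqP/indep B1; rewrite B1 eqxx in B0.
have Pt p : P (polE p).
  by have [A [B [/det_power_neq0 B0 pB]]] := polE_frac p; exists A, B.
apply: U_gen => [|k|i j].
- split=> //; first by have := Pc 1; rewrite rmorph1.
  move=> y z Py Pz; apply: PD => //; rewrite -mulN1r; apply: PM => //.
  by have := Pc (-1); rewrite rmorphN1.
- by have [p [r [r0 ->]]] := iota_frac k; apply: PM => //; apply: PV.
- by rewrite U_poly; apply: is_frac_mmap.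
Qed.

Lemma solution_lift V : is_solution V -> exists s : {rmorphism E -> E},
  (forall k, s (iota k) = iota k) /\ map_mx s U = V.
Proof.
move=> Vsol; have [VA Vu VE] := Vsol; have [UA Uu UE] := U_sol.
have [||Q Q0|f [fhom fpoly _]] := @frac_extension _ _ _ _ constE u constE
  (acoord constE ^~ V) (fun Q => Q != 0) (solution_indep U_sol).
- exact: oner_neq0.
- by move=> P Q; apply: mulf_neq0.
- exists (mmap constE (acoord constE ^~ V) Q)^-1; rewrite mulfV //.
  by apply: contraNneq Q0 => /(solution_indep Vsol) ->.
have {fhom}/ringhom_rmorphism[s sE] : ringhom f.
  by case: fhom => fD fM f1; split=> // x y _ _; [apply: fD | apply: fM]; apply: frac_u.
rewrite {f}sE in fpoly.
have sc c : s (constE c) = constE c by have := fpoly c%:MP; rewrite !mmapC.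
have sU : map_mx s U = V.
  rewrite -(elt_acoord kappaP UA) elt_map -[RHS](elt_acoord kappaP VA).
  by apply: elt_eq => // i /=; have := fpoly 'X_i; rewrite !mmapX !mmap1U.
have sUq : map_mx s (frobq F U) = frobq F V.
  by rewrite -sU /frobq -!map_mx_comp; apply: eq_map_mx => x /=; rewrite rmorphXn.
(* Applying [s] to [A U^(q) = U] gives an equation for [V] with the matrix [s(A)]; since [V^(q)] is
   invertible, [s(A) = A]. *)
have st i : s (tE i) = tE i.
  have : elt a constE (s \o tE) *m frobq F V = elt a constE tE *m frobq F V.
    rewrite VE -[RHS]sU -[in RHS]UE map_mxM sUq elt_map; congr (_ *m _).
    by apply: elt_eq => // c; rewrite /= sc.
  have Vqu : frobq F V \in unitmx by rewrite frobq_map map_unitmx.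
  move/(congr1 (mulmx^~ (invmx (frobq F V)))); rewrite -!mulmxA mulmxV // !mulmx1.
  by move/(congr1 (acoord constE i)); rewrite !acoord_elt.
exists s; split=> // k.
have sp p : s (polE p) = polE p.
  by rewrite polE_mmap mmap_rmorph; apply: eq_mmap => // i /=; apply: st.
by have [p [q [q0 ->]]] := iota_frac k; rewrite rmorphM fmorphV !sp.
Qed.

Lemma galmap_const (s : {rmorphism E -> E}) (g : 'M[F]_n) : (forall k, s (iota k) = iota k) ->
  map_mx s (map_mx constE g) = map_mx constE g.
Proof. by move=> sK; rewrite -map_mx_comp; apply: eq_map_mx => c /=; apply: sK. Qed.

Lemma gal_quotient s : Kaut iota s -> exists g, inG a g /\ galmap iota U s g.
Proof.
move=> [/ringhom_rmorphism[f ->] _ fK]; have [UA Uu UE] := U_sol.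
have fc c : f (constE c) = constE c by apply: fK.
have fUq : map_mx f (frobq F U) = frobq F (map_mx f U).
  by rewrite /frobq -!map_mx_comp; apply: eq_map_mx => x /=; rewrite rmorphXn.
have fsol : is_solution (map_mx f U).
  split; rewrite ?map_unitmx //.
  - by have := inAT_map f UA; apply: inAT_eq => c /=.
  - rewrite -[in RHS]UE map_mxM fUq elt_map; congr (_ *m _).
    by apply: elt_eq => [c|i] /=; rewrite ?fc // /tE; apply/esym/fK.
by have [g gG fU] := solution_quotient U_sol fsol; exists g.
Qed.

(** The lift of [g] is bijective with the lift of [g^-1] as inverse: both composites fix [K] and
    [U]. *)
Lemma gal_exists g : inG a g -> exists s, [/\ Kaut iota s, galmap iota U s g &
  forall s', Kaut iota s' -> galmap iota U s' g -> s' =1 s].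
Proof.
move=> gG; have lift h (hG : inG a h) := solution_lift (solution_mul U_sol hG).
have [s [sK sU]] := lift g gG; have [r [rK rU]] := lift _ (inGV gG).
have [_ gu] := gG.
have comp_id (f f' : {rmorphism E -> E}) h k : (forall x, f (iota x) = iota x) ->
    (forall x, f' (iota x) = iota x) -> h *m k = 1%:M ->
    map_mx f U = U *m map_mx constE h -> map_mx f' U = U *m map_mx constE k ->
    f \o f' =1 (idfun : {rmorphism E -> E}).
  move=> fK f'K hk fU f'U; have ffU : map_mx (f \o f') U = map_mx idfun U.
    rewrite [RHS]map_mx_id // map_mx_comp f'U map_mxM fU galmap_const // -mulmxA -map_mxM.
    by rewrite hk map_mx1 mulmx1.
  by apply: Kaut_ext => [x|//|]; [rewrite /= f'K fK | exact: ffU].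
have sr := comp_id _ _ _ _ sK rK (mulmxV gu) sU rU.
have rs := comp_id _ _ _ _ rK sK (mulVmx gu) rU sU.
exists s; split=> //; first by split=> //; [exact: rmorphism_ringhom | exists r].
move=> s' [/ringhom_rmorphism[f ->] _ fK] fU; apply: Kaut_ext => //.
by rewrite sU.
Qed.

Lemma gal_comp s s' g h : Kaut iota s -> Kaut iota s' ->
  galmap iota U s g -> galmap iota U s' h -> galmap iota U (s \o s') (g *m h).
Proof.
move=> [/ringhom_rmorphism[f ->] _ fK] [/ringhom_rmorphism[f' ->] _ fK'] fU fU'.
rewrite /galmap map_mx_comp fU' map_mxM fU -mulmxA; congr (_ *m _).
by rewrite (galmap_const h fK); apply/esym/(map_mxM constE).
Qed.

(** * S/R as a Galois extension *)

Local Notation S := (inS a iota U).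

Lemma cardF1_gt0 : (0 < #|F|.-1)%N.
Proof. by have := cardF_gt1 F; case: #|F| => [|[]]. Qed.

Lemma S_subring : Defs.subring_closed S.
Proof.
split=> [P [P1 _ _] _ _ //|x y Sx Sy P PS PR PU|x y Sx Sy P PS PR PU].
- by case: (PS) => _ PB _; apply: PB; [apply: Sx | apply: Sy].
- by case: (PS) => _ _ PM; apply: PM; [apply: Sx | apply: Sy].
Qed.
Lemma S1 : S 1. Proof. by case: S_subring. Qed.
Lemma SB x y : S x -> S y -> S (x - y). Proof. by case: S_subring => _ H _; apply: H. Qed.
Lemma SM x y : S x -> S y -> S (x * y). Proof. by case: S_subring => _ _; apply. Qed.
Lemma S0 : S 0. Proof. by rewrite -(subrr 1); apply: SB S1 S1. Qed.
Lemma SN x : S x -> S (- x). Proof. by rewrite -sub0r; apply: SB S0. Qed.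
Lemma SD x y : S x -> S y -> S (x + y).
Proof. by move=> Sx Sy; rewrite -[y]opprK; apply: SB Sx (SN Sy). Qed.
Lemma S_sum (I : Type) (r : seq I) (P : pred I) (G : I -> E) :
  (forall i, P i -> S (G i)) -> S (\sum_(i <- r | P i) G i).
Proof. move=> SG; exact: (big_ind S S0 SD SG). Qed.
Lemma S_prod (I : Type) (r : seq I) (P : pred I) (G : I -> E) :
  (forall i, P i -> S (G i)) -> S (\prod_(i <- r | P i) G i).
Proof. move=> SG; exact: (big_ind S S1 SM SG). Qed.
Lemma SX x k : S x -> S (x ^+ k).
Proof. by move=> Sx; elim: k => [|k IH]; rewrite ?expr0 ?exprS; [exact: S1 | apply: SM]. Qed.
Lemma S_R r : inR a r -> S (iota r). Proof. by move=> Rr P _ PR _; apply: PR. Qed.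
Lemma S_U i j : S (U i j). Proof. by move=> P _ _; apply. Qed.
Lemma S_pol p : S (polE p).
Proof. by apply: S_R; exists p, 0; rewrite expr0 divr1. Qed.
Lemma S_const c : S (constE c). Proof. exact: S_pol. Qed.
Lemma S_det k (N : 'M[E]_k) : (forall i j, S (N i j)) -> S (\det N).
Proof.
move=> SN'; apply: S_sum => s _; apply: SM; last exact: S_prod.
by apply: SX; apply: SN S1.
Qed.

(** Since [d = det(U)^(1-q)], the inverse of [det U] is already in [S], and [U] is invertible over
    [S]. *)
Lemma det_U_inv : (\det U)^-1 = \det U ^+ #|F|.-2 * polE (dpoly a).
Proof.
have U0 := det_solution_neq0 U_sol; apply: (mulfI U0); rewrite mulfV //.
apply: (mulfI U0); rewrite mulr1 -[LHS]det_tu !mulrA -expr2 -exprD.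
by congr (_ ^+ _ * _); have := cardF_gt1 F; lia.
Qed.

Lemma S_invU i j : S (invmx U i j).
Proof.
have [_ Uu _] := U_sol; rewrite /invmx Uu mxE det_U_inv; apply: SM.
  by apply: SM; [apply: SX; apply: S_det => *; apply: S_U | apply: S_pol].
rewrite mxE; apply: SM; first by apply: SX; apply: SN S1.
by apply: S_det => k l; rewrite !mxE; apply: S_U.
Qed.

Section Action.
Variable act : 'M[F]_n -> E -> E.
Hypothesis actP : forall g, inG a g -> Kaut iota (act g) /\ galmap iota U (act g) g.

Lemma actE g : inG a g -> exists f : {rmorphism E -> E},
  [/\ act g = f, forall k, f (iota k) = iota k & map_mx f U = U *m map_mx constE g].
Proof. by move=> /actP[[/ringhom_rmorphism[f ->] _ fK] fU]; exists f. Qed.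

Lemma act_S g s : inG a g -> S s -> S (act g s).
Proof.
move=> gG Ss; have [f [-> fK fU]] := actE gG.
apply: (Ss (fun x => S (f x))) => [|r Rr|i j].
- split=> [|x y Sx Sy|x y Sx Sy]; first by rewrite rmorph1; exact: S1.
  + by rewrite rmorphB; apply: SB.
  + by rewrite rmorphM; apply: SM.
- by rewrite fK; apply: S_R.
- have /matrixP/(_ i j) := fU; rewrite !mxE => ->.
  by apply: S_sum => k _; apply: SM (S_U _ _) _; rewrite mxE; apply: S_const.
Qed.

Lemma act1 s : act 1%:M s = s.
Proof.
have [f [-> fK fU]] := actE inG1.
apply: (@Kaut_ext f (idfun : {rmorphism E -> E}) fK (fun _ => erefl) _ s).
by rewrite fU map_mx1 mulmx1 [RHS]map_mx_id.
Qed.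

Lemma act_mul g h s : inG a g -> inG a h -> act (g *m h) s = act g (act h s).
Proof.
move=> gG hG; have [f [-> fK fU]] := actE gG; have [f' [-> fK' fU']] := actE hG.
have [k [-> kK kU]] := actE (inGM gG hG).
apply: (@Kaut_ext k (f \o f') kK _ _ s) => [x|]; first by rewrite /= fK' fK.
rewrite kU [RHS]map_mx_comp fU' [in RHS]map_mxM fU galmap_const // -mulmxA.
by rewrite -map_mxM.
Qed.

(* These functions on the group form a ring that contains [g |-> g i j], because
   [g = U^-1 * act g U]; hence it contains the indicator function of [1]. *)
Definition expressible (f : 'M[F]_n -> E) : Prop := exists s : seq (E * E),
  (forall z, z \in s -> S z.1 /\ S z.2) /\
  forall g, inG a g -> f g = \sum_(z <- s) z.1 * act g z.2.

Lemma expressible_act x y : S x -> S y -> expressible (fun g => x * act g y).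
Proof.
move=> Sx Sy; exists [:: (x, y)]; split=> [z|g _]; last by rewrite big_seq1.
by rewrite inE => /eqP ->.
Qed.

Lemma expressible_const x : S x -> expressible (fun=> x).
Proof.
move=> Sx; have [s [sS sE]] := expressible_act Sx S1; exists s; split=> // g gG.
by rewrite -sE //; have [f [-> _ _]] := actE gG; rewrite rmorph1 mulr1.
Qed.

Lemma expressibleD f f' : expressible f -> expressible f' ->
  expressible (fun g => f g + f' g).
Proof.
move=> [s [sS sE]] [s' [sS' sE']]; exists (s ++ s'); split=> [z|g gG].
  by rewrite mem_cat => /orP[/sS|/sS'].
by rewrite big_cat sE // sE'.
Qed.

Lemma expressibleM f f' : expressible f -> expressible f' ->
  expressible (fun g => f g * f' g).
Proof.
move=> [s [sS sE]] [s' [sS' sE']].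
exists [seq (z.1 * w.1, z.2 * w.2) | z <- s, w <- s']; split=> [z|g gG].
  case/allpairsP => -[[x y] [x' y']] /= [/sS[? ?] /sS'[? ?] ->].
  by split; apply: SM.
rewrite sE // sE' // big_allpairs_dep mulr_suml; apply: eq_bigr => z _.
rewrite mulr_sumr; apply: eq_bigr => w _ /=; have [h [-> _ _]] := actE gG.
by rewrite rmorphM mulrACA.
Qed.

Lemma eq_expressible f f' : (forall g, inG a g -> f g = f' g) ->
  expressible f -> expressible f'.
Proof. by move=> ff' [s [sS sE]]; exists s; split=> // g gG; rewrite -ff' // sE. Qed.

Lemma expressible_sum (I : Type) (r : seq I) (f : I -> 'M[F]_n -> E) :
  (forall i, expressible (f i)) -> expressible (fun g => \sum_(i <- r) f i g).
Proof.
move=> fE; elim: r => [|i r IH].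
  by apply: eq_expressible (expressible_const S0) => g _; rewrite big_nil.
by apply: eq_expressible (expressibleD (fE i) IH) => g _; rewrite big_cons.
Qed.

Lemma expressible_prod (I : Type) (r : seq I) (f : I -> 'M[F]_n -> E) :
  (forall i, expressible (f i)) -> expressible (fun g => \prod_(i <- r) f i g).
Proof.
move=> fE; elim: r => [|i r IH].
  by apply: eq_expressible (expressible_const S1) => g _; rewrite big_nil.
by apply: eq_expressible (expressibleM (fE i) IH) => g _; rewrite big_cons.
Qed.

Lemma expressibleX f k : expressible f -> expressible (fun g => f g ^+ k).
Proof.
move=> fE; apply: eq_expressible (expressible_prod (index_enum 'I_k) (fun=> fE)) => g _.
by rewrite prodr_const card_ord.
Qed.

Lemma expressible_entry i j : expressible (fun g => constE (g i j)).
Proof.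
have [_ Uu _] := U_sol.
apply: eq_expressible (expressible_sum (index_enum 'I_n)
  (fun k => expressible_act (S_invU i k) (S_U k j))) => g gG.
have [f [-> _ fU]] := actE gG; transitivity ((invmx U *m map_mx f U) i j).
  by rewrite mxE; apply: eq_bigr => k _; rewrite [in RHS]mxE.
by rewrite fU mulKmx // mxE.
Qed.

(** On [F], the function [1 - x^(q-1)] is the indicator of zero; the product is over all entries of
    [g - 1]. *)
Lemma expressible_delta : expressible (fun g => (g == 1%:M)%:R).
Proof.
pose d g i j := 1 - (constE (g i j) - constE ((1%:M : 'M[F]_n) i j)) ^+ #|F|.-1.
have dE i j : expressible (fun g => d g i j).
  apply: eq_expressible (expressibleD (expressible_const S1)
    (expressibleM (expressible_const (SN S1)) (expressibleX #|F|.-1 (expressibleD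
     (expressible_entry i j) (expressible_const (SN (S_const ((1%:M : 'M[F]_n) i j)))))))).
  by move=> g _; rewrite mulN1r.
apply: eq_expressible (expressible_prod (index_enum 'I_n)
  (fun i => expressible_prod (index_enum 'I_n) (dE i))) => g _.
have [->|g1] := eqVneq g 1%:M.
  apply: big1 => i _; apply: big1 => j _.
  by rewrite /d subrr expr0n eqn0Ngt cardF1_gt0 subr0.
have /existsP[i /existsP[j gij]] : [exists i, exists j, g i j != (1%:M : 'M[F]_n) i j].
  apply: contraNT g1 => /existsPn ng; apply/eqP/matrixP => i j.
  by have /existsPn/(_ j) := ng i; rewrite negbK => /eqP.
rewrite (bigD1 i) //= (bigD1 j) //= /d -rmorphB -rmorphXn.
have -> : (g i j - (1%:M : 'M[F]_n) i j) ^+ #|F|.-1 = 1.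
  have x0 : g i j - (1%:M : 'M[F]_n) i j != 0 by rewrite subr_eq0.
  apply: (mulfI x0); rewrite mulr1 -exprS prednK ?expf_card //.
  exact: ltnW (cardF_gt1 F).
by rewrite rmorph1 subrr !mul0r.
Qed.

Lemma galois_data : exists (k : nat) (x y : 'I_k -> E), (forall i, S (x i) /\ S (y i)) /\
  forall g, inG a g -> \sum_(i < k) x i * act g (y i) = (if g == 1%:M then 1 else 0).
Proof.
have [s [sS sE]] := expressible_delta.
exists (size s), (fun i => (nth (0, 0) s i).1), (fun i => (nth (0, 0) s i).2).
split=> [i|g gG]; first by apply: sS; apply: mem_nth.
transitivity (\sum_(z <- s) z.1 * act g z.2); first by rewrite (big_nth (0, 0)) big_mkord.
by rewrite -sE //; case: eqP.
Qed.


(** * The invariants of [S] *)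

Local Notation q := #|F|.
Local Notation delta := (polE (dpoly a)).

Lemma det_tE : \det (elt a constE tE) = delta.
Proof. by rewrite polE_mmap mmap_dpoly. Qed.

Lemma delta_neq0 : delta != 0.
Proof.
apply: contraNneq (det_solution_neq0 U_sol) => d0.
by rewrite -[\det U]det_tu d0 mulr0.
Qed.

(* [U] is not integral over [F[t]], but [delta *: U] is: its entries satisfy
   [V^(q) = delta^(q-2) \adj(A) V]. *)
Definition scaled_mx (Y : 'M[F]_n) : 'M[E]_n := delta *: (U *m map_mx constE Y).
Definition scaled_coord (Y : 'M[F]_n) (i : 'I_m) : E := acoord constE i (scaled_mx Y).

Definition scaled_eq_mx : 'M[Pol F m]_n := dpoly a ^+ q.-2 *: \adj (Apoly a).
Definition scaled_eq (j l : 'I_m) : Pol F m :=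
  acoord (@mpolyC m F) j (scaled_eq_mx *m map_mx (@mpolyC m F) (a l)).

Lemma scaled_inAT Y : inA a Y -> inAT a constE (scaled_mx Y).
Proof.
case: U_sol => UA _ _ YA; apply: inATZ; apply: (inATM AM UA); exact: inAT_inA.
Qed.

Lemma scaled_elt Y : inA a Y -> elt a constE (scaled_coord Y) = scaled_mx Y.
Proof. by move=> YA; apply: elt_acoord => //; apply: scaled_inAT. Qed.

Lemma scaled_frob Y : map_mx frobE (scaled_mx Y) = map_mx polE scaled_eq_mx *m scaled_mx Y.
Proof.
have [UA Uu UE] := U_sol.
have -> : map_mx polE scaled_eq_mx = delta ^+ q.-2 *: \adj (elt a constE tE).
  rewrite map_mxZ rmorphXn map_mx_adj -map_Apoly /=; congr (_ *: \adj _).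
  by apply: eq_map_mx => p; rewrite polE_mmap.
rewrite /scaled_mx map_mxZ map_mxM frobEE -frobq_map -scalemxAl -scalemxAr scalerA.
rewrite mulmxA -{2}UE mulmxA mul_adj_mx det_tE mul_scalar_mx -!scalemxAl scalerA.
have -> : map_mx frobE (map_mx constE Y) = map_mx constE Y.
  by rewrite -map_mx_comp; apply: eq_map_mx => c /=; apply: frobE_const.
(* Two factors [delta], one from the scaling and one from [adj(A) A = delta], complete [delta^(q-2)]
   to [delta^q]. *)
by congr (_ *: _); rewrite -!exprSr; congr (_ ^+ _); have := cardF_gt1 F; lia.
Qed.

Lemma scaled_solution Y : inA a Y -> frob_solution polE q scaled_eq (scaled_coord Y).
Proof.
move=> YA j; rewrite -frobEE -(acoord_map kappa).
rewrite (acoord_eq kappa (h' := constE)); last by move=> c; apply: frobE_const.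
rewrite scaled_frob -{1}(scaled_elt YA) mulmx_sumr linear_sum; apply: eq_bigr => l _ /=.
rewrite -scalemxAr linearZ /= mulrC; congr (_ * _).
apply: etrans (acoord_map kappa (mpolyC m (R:=F)) polE j _); rewrite map_mxM; congr (acoord _ _ (_ *m _)).
by rewrite -map_mx_comp.
Qed.

Definition comb (y : {ffun 'I_m -> F}) : 'M[F]_n := \sum_i y i *: a i.

Lemma comb_inA y : inA a (comb y). Proof. by exists y. Qed.

(** Multiplying by [(delta U)^-1] recovers [Y], so functions of [Y] can be written in the scaled
    coordinates, where exponents are reducible. *)
Lemma scaled_coord_lin i : exists cf : 'I_m -> E, forall y,
  \sum_l cf l * scaled_coord (comb y) l = constE (y i).
Proof.
have [UA Uu UE] := U_sol.
exists (fun l => acoord constE i (delta^-1 *: invmx U *m map_mx constE (a l))) => y.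
transitivity (acoord constE i (delta^-1 *: invmx U *m scaled_mx (comb y))).
  rewrite -(scaled_elt (comb_inA y)) mulmx_sumr linear_sum; apply: eq_bigr => l _ /=.
  by rewrite -scalemxAr linearZ /= mulrC.
rewrite /scaled_mx -scalemxAl -scalemxAr scalerA mulVf ?delta_neq0 // scale1r mulKmx //.
have -> : map_mx constE (comb y) = elt a constE (fun j => constE (y j)).
  by rewrite map_mx_sum; apply: eq_bigr => j _; rewrite map_mxZ.
by rewrite acoord_elt.
Qed.

(* There are as many reduced monomials as points of [F ^ m], and they span all
   functions on [F ^ m] because they span the indicator functions of points. *)
Lemma small_mnm_free (c : {ffun 'I_m -> 'I_q} -> E) :
  (forall y, \sum_al c al * small_mnm (scaled_coord (comb y)) al = 0) -> forall al, c al = 0.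
Proof.
move=> c0; pose I := {ffun 'I_m -> 'I_q}; pose Y := {ffun 'I_m -> F}.
pose Mu := \matrix_(i < #|I|, j < #|Y|) small_mnm (scaled_coord (comb (enum_val j))) (enum_val i).
have eqIY : #|I| = #|Y| by rewrite !card_ffun card_ord.
have /fin_all_exists[cf cfP] := scaled_coord_lin.
have delta_span (y0 : Y) : exists k : I -> E,
    forall y, (y == y0)%:R = \sum_al k al * small_mnm (scaled_coord (comb y)) al.
  (* The indicator of [y0], as a product of factors [1 - x^(q-1)], expressed in the scaled
     coordinates; its reduction has the same values. *)
  pose P : {mpoly E[m]} := \prod_i (1 - (\sum_l (cf i l)%:MP * 'X_l - (constE (y0 i))%:MP) ^+ q.-1).
  have [k kP] := reducible_mmap (idfun : {rmorphism E -> E})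
    (fun j l => polE (scaled_eq j l)) (cardF_gt1 F) P.
  exists k => y; rewrite -kP; last by move=> j; rewrite (scaled_solution (comb_inA y)).
  rewrite rmorph_prod.
  transitivity (\prod_i ((1 : E) - (constE (y i - y0 i)) ^+ q.-1)); last first.
    apply: eq_bigr => i _; rewrite [RHS]rmorphB [X in _ = X - _]rmorph1 [in RHS]rmorphXn.
    congr (_ - _ ^+ _); rewrite [LHS]rmorphB [RHS]rmorphB [in RHS]rmorph_sum [X in _ = _ - X]mmapC.
    congr (_ - _).
    by rewrite -cfP; apply: eq_bigr => l _; rewrite rmorphM /= mmapC mmapX mmap1U.
  have [->|yy0] := eqVneq y y0.
    by rewrite big1 // => i _; rewrite subrr rmorph0 expr0n eqn0Ngt cardF1_gt0 subr0.
  have /existsP[i yi] : [exists i, y i != y0 i].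
    by apply: contraNT yy0 => /existsPn ny; apply/eqP/ffunP => i; apply/eqP/negbNE/ny.
  have pow1 : (y i - y0 i) ^+ q.-1 = 1.
    have x0 : y i - y0 i != 0 by rewrite subr_eq0.
    by apply: (mulfI x0); rewrite mulr1 -exprS prednK ?expf_card // (ltnW (cardF_gt1 F)).
  by rewrite (bigD1 i) // -rmorphXn pow1 rmorph1 subrr /= mul0r.
have /row_freeP[N MuN] : row_free Mu.
  have : row_full Mu.
    have /fin_all_exists[k kP] := delta_span.
    apply/row_fullP; exists (\matrix_(j, i) k (enum_val j) (enum_val i)).
    apply/matrixP => j j'; rewrite !mxE eq_sym -(inj_eq enum_val_inj) kP.
    rewrite (reindex (@enum_val I predT)) /=; last exact: onW_bij (@enum_val_bij _).
    by apply: eq_bigr => i _; rewrite !mxE.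
  by rewrite /row_free /row_full => /eqP ->; rewrite eq_sym; apply/eqP.
pose r : 'rV_#|I| := \row_i c (enum_val i).
have rMu : r *m Mu = 0.
  apply/rowP => j; rewrite !mxE -[RHS](c0 (enum_val j)).
  rewrite [RHS](reindex (@enum_val I predT)) /=; last exact: onW_bij (@enum_val_bij _).
  by apply: eq_bigr => i _; rewrite !mxE.
have r0 : r = 0 by rewrite -[r]mulmx1 -MuN mulmxA rMu mul0mx.
by move=> al; have /rowP/(_ (enum_rank al)) := r0; rewrite !mxE enum_rankK.
Qed.

Lemma S_scaled_poly x : S x ->
  exists k (P : {mpoly (Pol F m)[m]}), delta ^+ k * x = mmap polE (scaled_coord 1%:M) P.
Proof.
have ev (P : {mpoly (Pol F m)[m]}) c : mmap polE (scaled_coord 1%:M) (c%:MP * P) =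
    polE c * mmap polE (scaled_coord 1%:M) P by rewrite rmorphM /= mmapC.
have evB (P P' : {mpoly (Pol F m)[m]}) c c' :
    mmap polE (scaled_coord 1%:M) (c%:MP * P - c'%:MP * P') =
    polE c * mmap polE (scaled_coord 1%:M) P - polE c' * mmap polE (scaled_coord 1%:M) P'.
  by rewrite -!ev -rmorphB.
have evM (P P' : {mpoly (Pol F m)[m]}) : mmap polE (scaled_coord 1%:M) (P * P') =
    mmap polE (scaled_coord 1%:M) P * mmap polE (scaled_coord 1%:M) P' by rewrite -rmorphM.
move=> Sx; apply: (Sx (fun y => exists k P,
  delta ^+ k * y = mmap polE (scaled_coord 1%:M) P)) => [|r [p [k ->]]|i j].
- split=> [|y z [k [P yP]] [k' [P' zP]]|y z [k [P yP]] [k' [P' zP]]].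
  + by exists 0, 1; rewrite rmorph1 mulr1.
  + exists (k + k')%N, ((dpoly a ^+ k')%:MP * P - (dpoly a ^+ k)%:MP * P').
    by rewrite evB -yP -zP !rmorphXn exprD; ring.
  + by exists (k + k')%N, (P * P'); rewrite evM -yP -zP exprD; ring.
- exists k, p%:MP; rewrite mmapC mulrC rmorphM fmorphV rmorphXn.
  by rewrite -[iota (FracField.tofrac p)]/(polE p) mulfVK // expf_neq0 // delta_neq0.
- exists 1%N, (\sum_l (((a l i j)%:MP : Pol F m)%:MP * 'X_l)).
  have := congr1 (fun X : 'M[E]_n => X i j) (scaled_elt A1).
  rewrite /scaled_mx map_mx1 mulmx1 mxE expr1 => <-; rewrite summxE rmorph_sum.
  by apply: eq_bigr => l _; apply: etrans (esym (ev _ _)); rewrite mmapX mmap1U !mxE mulrC.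
Qed.

(* Let [z = delta ^ k * x = P(delta U)]. The identity [det(v) P(v)^N = z^N det(v)]
   holds at [v = delta U Y] for every [Y] of the algebra: by invariance of [x] if [Y]
   is invertible, and since [det(v) = 0] otherwise. Comparing coefficients of reduced
   monomials gives [c <> 0] in [F[t]] with [c z^N] in [F[t]] for all [N]. *)
Lemma S_fixed x : S x -> (forall g, inG a g -> act g x = x) -> inRE a iota x.
Proof.
move=> Sx x_fix; have [k [P zP]] := S_scaled_poly Sx.
set z := delta ^+ k * x in zP.
have z_fix g : inG a g -> mmap polE (scaled_coord g) P = z.
  move=> gG; have [f [fE fK fU]] := actE gG; have /(congr1 f) := zP.
  have fp p : f (polE p) = polE p by apply: fK.
  rewrite rmorphM rmorphXn fp -fE (x_fix g gG) -/z => ->.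
  rewrite fE mmap_rmorph; apply: eq_mmap => [p|i] /=; first by rewrite fp.
  rewrite -(acoord_map kappa) (acoord_eq kappa (h' := constE)); last first.
    by move=> c /=; apply: fK.
  by rewrite map_mxZ fp map_mxM !map_mx1 mulmx1 fU.
pose Dp : {mpoly (Pol F m)[m]} :=
  \det (elt a (@mpolyC m (Pol F m) \o @mpolyC m F) (fun i => 'X_i)).
have DpE Y : inA a Y -> mmap polE (scaled_coord Y) Dp = \det (scaled_mx Y).
  move=> YA; rewrite -(scaled_elt YA) -det_map_mx elt_map; congr (\det _).
  by apply: elt_eq => [c|i] /=; rewrite ?mmapC ?mmapX ?mmap1U.
have DzN N y : mmap polE (scaled_coord (comb y)) (Dp * P ^+ N)
    = z ^+ N * mmap polE (scaled_coord (comb y)) Dp.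
  rewrite rmorphM rmorphXn /= mulrC; have [yu|ynu] := boolP (comb y \in unitmx).
    by rewrite z_fix //; split=> //; apply: comb_inA.
  rewrite (DpE _ (comb_inA y)) /scaled_mx detZ det_mulmx det_map_mx.
  by move: ynu; rewrite unitmxE unitfE negbK => /eqP ->; rewrite rmorph0 !mulr0.
have redP Q := reducible_mmap polE scaled_eq (cardF_gt1 F) Q.
have [c0 c0P] := redP Dp.
have cN N al : exists w, polE w = z ^+ N * polE (c0 al).
  have [w wP] := redP (Dp * P ^+ N); exists (w al).
  apply/eqP; rewrite -subr_eq0; apply/eqP.
  apply: (small_mnm_free (c := fun be => polE (w be) - z ^+ N * polE (c0 be))) => y.
  have ysol := scaled_solution (comb_inA y).
  have /eqP := DzN N y; rewrite (wP _ ysol) (c0P _ ysol) -subr_eq0 => /eqP Dz.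
  rewrite -[RHS]Dz mulr_sumr -sumrB; apply: eq_bigr => be _.
  by rewrite mulrBl mulrA.
(* The determinant does not vanish at [delta U], so its reduced form is not zero. *)
have [al c0al] : exists al, c0 al != 0.
  apply/existsP/contraT => /existsPn c00.
  have := DpE 1%:M A1; rewrite (c0P _ (scaled_solution A1)) big1 => [|al _].
    move/esym/eqP; rewrite /scaled_mx map_mx1 mulmx1 detZ mulf_eq0 expf_eq0.
    by rewrite (negPf delta_neq0) (negPf (det_solution_neq0 U_sol)) andbF.
  by have := c00 al; rewrite negbK => /eqP ->; rewrite raddf0 mul0r.
have polE_inj : injective polE.
  by move=> p p' /eqP; rewrite -subr_eq0 -rmorphB polE_eq0 subr_eq0 => /eqP.
have [p pz] := cN 1%N al.
(* With [c = c0 al] and [p = c z], one has [c p^Q = (c z^Q) c^Q], where [c z^Q] is again a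
   polynomial in [t]. *)
have [r pr] : exists r, p = c0 al * r.
  apply: dvd_of_qpow => // j; have [w wz] := cN (q ^ j)%N al; exists w.
  by apply: polE_inj; rewrite !rmorphM !rmorphXn pz wz expr1 exprMn; ring.
have zr : z = polE r.
  have c00 : polE (c0 al) != 0 by rewrite polE_eq0.
  by apply: (mulIf c00); rewrite -[z]expr1 -pz pr rmorphM mulrC.
exists (@FracField.tofrac (Pol F m) r / @FracField.tofrac (Pol F m) (dpoly a) ^+ k).
split; first by exists r, k.
rewrite rmorphM fmorphV rmorphXn -[iota (FracField.tofrac r)]/(polE r) -zr.
by rewrite /z mulrC mulKf // expf_neq0 // delta_neq0.
Qed.

(** * Genericity *)

Lemma galois_ext : GaloisExt a (inRE a iota) S act.
Proof.
split.
- by move=> _ [r [Rr ->]]; apply: S_R.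
- move=> g gG; have [f [fE fK _]] := actE gG; split.
  + by move=> s; apply: act_S.
  + by rewrite fE; case: (rmorphism_ringhom f) => fD fM f1; split=> // x y _ _; [apply: fD | apply: fM].
  + by move=> _ [r [_ ->]]; rewrite fE fK.
- by move=> s _; apply: act1.
- by move=> g h s gG hG _; apply: act_mul.
- by split; [exact: S_fixed | exact: galois_data].
Qed.

Lemma ringhom_on_S0 (T : comNzRingType) (f : E -> T) : ringhom_on S f -> f 0 = 0.
Proof.
by case=> fD _ _; apply: (addrI (f 0)); rewrite -fD ?addr0 //; apply: S0.
Qed.

Lemma ringhom_on_S_sum (T : comNzRingType) (f : E -> T) (I : Type) (r : seq I) (P : pred I)
    (x : I -> E) : ringhom_on S f -> (forall i, P i -> S (x i)) ->
  f (\sum_(i <- r | P i) x i) = \sum_(i <- r | P i) f (x i).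
Proof.
move=> fS xS; have f0 := ringhom_on_S0 fS; case: fS => fD _ _.
suff [] : S (\sum_(i <- r | P i) x i) /\
  f (\sum_(i <- r | P i) x i) = \sum_(i <- r | P i) f (x i) by [].
elim/big_rec2: _ => [|i y z Pi [Sz <-]]; first by split=> //; apply: S0.
by have Sx := xS i Pi; split; [apply: SD | apply: fD].
Qed.

(** [S] lies in [F[u, 1 / det U]]: the [t i] have denominator [det U^q], and [1/d = det(U)^(q-1)] is
    even a polynomial in [u]. *)
Lemma S_frac s : S s -> is_frac constE u det_power s.
Proof.
have FD x y : is_frac constE u det_power x -> is_frac constE u det_power y ->
    is_frac constE u det_power (x + y) by exact: (is_fracD det_powerM).
have FM x y : is_frac constE u det_power x -> is_frac constE u det_power y ->
    is_frac constE u det_power (x * y) by exact: (is_fracM det_powerM).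
have Fc c : is_frac constE u det_power (constE c) by exact: (is_frac_const _ _ det_power1).
move=> Ss; apply: (Ss (is_frac constE u det_power)) => [|r [p [k ->]]|i j].
- split=> //; first by have := Fc 1; rewrite rmorph1.
  move=> x y Fx Fy; apply: FD => //; rewrite -mulN1r; apply: FM => //.
  by have := Fc (-1); rewrite rmorphN1.
- rewrite rmorphM fmorphV rmorphXn -[iota (FracField.tofrac p)]/(polE p).
  apply: FM; first exact: polE_frac.
  exists ((dpoly a ^+ #|F|.-1) ^+ k), 1; split; first exact: det_power1.
  rewrite rmorph1 mulr1 !rmorphXn /= mmap_u_dpoly -exprVn; congr (_ ^+ _).
  have U0 := det_solution_neq0 U_sol; have d0 := delta_neq0.
  apply: (mulIf d0); rewrite mulVf //; apply: (mulfI U0).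
  by rewrite mulr1 mulrA -exprS prednK ?det_tu // (ltnW (cardF_gt1 F)).
- by rewrite U_poly; apply: is_frac_mmap det_power1 _.
Qed.

(** * The base change of [S] to a Galois algebra [M] over [L] *)

Section BaseChange.
Variables (L : fieldType) (jF : {rmorphism F -> L}).
Variables (M : comNzRingType) (jL : {rmorphism L -> M}).
Variable sig : 'M[F]_n -> {rmorphism M -> M}.
Hypothesis sig_L : forall g l, g \in unitset a -> sig g (jL l) = jL l.
Hypothesis fixed_L : forall x, (forall g, g \in unitset a -> sig g x = x) ->
  exists l, x = jL l.
Hypothesis sig1 : forall x, sig 1%:M x = x.
Hypothesis sigM : forall g h x, g \in unitset a -> h \in unitset a ->
  sig (g *m h) x = sig g (sig h x).

Definition jM : {rmorphism F -> M} := jL \o jF.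

Lemma jL_inj : injective jL. Proof. exact: fmorph_inj. Qed.

Section Torsor.
Variables V W : 'M[M]_n.
Hypothesis V_A : inAT a jM V.
Hypothesis VW : V *m W = 1%:M.
Hypothesis V_tw : twisted_fixed a jM sig id V.
Local Notation v := (acoord jM ^~ V).

Lemma elt_v : elt a jM v = V. Proof. exact: elt_acoord. Qed.

(** [sig g] turns [V] into [V g] and [V^(q)] into [V^(q) g], as Frobenius fixes [g]; the twists
    cancel in [V (V^(q))^-1]. *)
Lemma torsor_base : exists l : 'I_m -> L,
  elt a jM (jL \o l) *m map_mx (fun x => x ^+ #|F|) V = V.
Proof.
have [f fE] := qpow_rmorphism jM 1.
have fq : map_mx (fun x => x ^+ #|F|) V = map_mx f V.
  by apply: eq_map_mx => x; rewrite fE /qpow expn1.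
have fc c : f (jM c) = jM c by rewrite fE /qpow -rmorphXn -/(qpow F 1 c) qpowF.
have fconst (g : 'M[F]_n) : map_mx f (map_mx jM g) = map_mx jM g.
  by rewrite -map_mx_comp; apply: eq_map_mx => c /=; apply: fc.
have WV := mulmx1C VW.
pose B := V *m map_mx f W.
have BA : inAT a jM B.
  apply: (inATM AM) => //; have := inAT_map f (inAT_inv A1 AM V_A VW).
  by apply: inAT_eq => c; apply: fc.
have Bfix g : g \in unitset a -> map_mx (sig g) B = B.
  move=> gG; have gu := unitset_unit gG.
  have sW : map_mx (sig g) W = map_mx jM (invmx g) *m W.
    have /(congr1 (mulmx (map_mx jM (invmx g) *m W))) : V *m map_mx jM g *m map_mx (sig g) W = 1%:M.
      by rewrite -V_tw // -map_mxM VW map_mx1.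
    rewrite mulmx1 => <-; rewrite !mulmxA -[_ *m W *m V]mulmxA WV mulmx1 -map_mxM mulVmx //.
    by rewrite map_mx1 mul1mx.
  rewrite map_mxM V_tw // -map_mx_comp.
  have -> : map_mx (sig g \o f) W = map_mx f (map_mx (sig g) W).
    by rewrite -[RHS]map_mx_comp; apply: eq_map_mx => x /=; rewrite fE /qpow rmorphXn.
  rewrite sW map_mxM fconst mulmxA -[V *m _ *m _]mulmxA -map_mxM mulmxV //.
  by rewrite map_mx1 mulmx1.
have /fin_all_exists[l lP] : forall i, exists l, acoord jM i B = jL l.
  move=> i; apply: fixed_L => g gG; rewrite -(acoord_map kappa).
  rewrite (acoord_eq kappa (h' := jM)) ?Bfix // => c.
  exact: sig_L.
exists l; have -> : elt a jM (jL \o l) = B.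
  by rewrite -[RHS](elt_acoord kappaP BA); apply: elt_eq => // i /=; rewrite lP.
by rewrite fq /B -mulmxA -map_mxM WV map_mx1 mulmx1.
Qed.

Section Morphisms.
Variable l : 'I_m -> L.
Hypothesis lP : elt a jM (jL \o l) *m map_mx (fun x => x ^+ #|F|) V = V.

Lemma det_V_inv k : exists w, mmap jM v (dpoly a ^+ k) * w = 1.
Proof.
exists (\det W ^+ k); rewrite rmorphXn /= mmap_dpoly elt_v -exprMn -det_mulmx VW.
by rewrite det1 expr1n.
Qed.

Lemma det_l_neq0 : mmap jF l (dpoly a) != 0.
Proof.
apply/eqP => d0; have := congr1 (fun X => \det X * \det W) lP.
rewrite -[RHS]det_mulmx VW det1 det_mulmx.
have -> : elt a jM (jL \o l) = map_mx jL (elt a jF l) by rewrite elt_map.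
rewrite det_map_mx -mmap_dpoly d0 rmorph0 !mul0r => /eqP.
by rewrite eq_sym oner_eq0.
Qed.

Lemma exists_phi : exists phi : Kfield F m -> L,
  [/\ ringhom_on (inR a) phi, forall p, phi (FracField.tofrac p) = mmap jF l p &
      forall p k, phi (FracField.tofrac p / FracField.tofrac (dpoly a) ^+ k)
        * mmap jF l (dpoly a) ^+ k = mmap jF l p].
Proof.
pose e : {rmorphism F -> Kfield F m} := @FracField.tofrac (Pol F m) \o @mpolyC m F.
have eE p : mmap e (fun i => FracField.tofrac 'X_i) p = FracField.tofrac p.
  exact/esym/(@mmap_unique _ _ _ e (fun i => FracField.tofrac 'X_i) (@FracField.tofrac (Pol F m))).
have [||||phi [phi_hom phi_poly phi_frac]] := @frac_extension _ _ _ _ e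
  (fun i => FracField.tofrac 'X_i) jF l det_power.
- by move=> P /eqP; rewrite eE tofrac_eq0 => /eqP.
- exact: det_power1.
- exact: det_powerM.
- move=> _ [k ->]; exists (mmap jF l (dpoly a ^+ k))^-1.
  by rewrite mulfV // rmorphXn expf_neq0 // det_l_neq0.
have d0 : dpoly a != 0 by apply: det_power_neq0; exists 1%N.
exists phi; split=> [|p|p k]; last 2 first.
- by rewrite -eE phi_poly.
- have -> : mmap jF l (dpoly a) ^+ k = mmap jF l (dpoly a ^+ k) by rewrite rmorphXn.
  apply: phi_frac; first by exists k.
  by rewrite !eE; exact: tofrac_divK.
have R_frac x : inR a x -> is_frac e (fun i => FracField.tofrac 'X_i) det_power x.
  move=> [p [k ->]]; exists p, (dpoly a ^+ k); split; first by exists k.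
  by rewrite !eE; exact: tofrac_divK.
by case: phi_hom => hD hM h1; split=> // x y /R_frac Rx /R_frac Ry; [apply: hD | apply: hM].
Qed.

(** The map is [u |-> v]. It sends [t i] to [l i] because [lang_poly] computes both by the same
    polynomials, from [U] and from [V]. *)
Lemma exists_psi : exists psi : E -> M,
  [/\ ringhom_on S psi, forall P, psi (mmap constE u P) = mmap jM v P &
      forall p, psi (polE p) = jL (mmap jF l p)].
Proof.
have [||||psi [psi_hom psi_poly psi_frac]] := @frac_extension _ _ _ _ constE
  u jM v det_power.
- exact: solution_indep.
- exact: det_power1.
- exact: det_powerM.
- by move=> _ [k ->]; apply: det_V_inv.
have psiS : ringhom_on S psi.
  by case: psi_hom => hD hM h1; split=> // x y /S_frac Sx /S_frac Sy; [apply: hD | apply: hM].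
have [hD hM h1] := psiS.
exists psi; split=> // p; rewrite mmap_rmorph.
elim/mpoly_ring_ind: p => [p p' IH IH'|p p' IH IH'|c|i].
- by rewrite !rmorphD hD ?IH ?IH' //; apply: S_pol.
- by rewrite !rmorphM hM ?IH ?IH' //; apply: S_pol.
- by rewrite mmapC; have := psi_poly c%:MP; rewrite !mmapC.
have [Ps PsP] := lang_poly; have [UA _ UE] := U_sol.
have [w dw] := det_V_inv #|F|.
have dV : mmap jM v (dpoly a ^+ #|F|) = \det V ^+ #|F|.
  by rewrite rmorphXn /= mmap_dpoly elt_v.
rewrite mmapX mmap1U /= -[LHS]mulr1 -[RHS]mulr1 -dw !mulrA; congr (_ * _).
rewrite (psi_frac (tE i) (Ps i)) //; last 2 first.
- by exists #|F|.
- by rewrite rmorphXn /= mmap_u_dpoly -(PsP _ _ _ tE) elt_acoord.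
by rewrite -(PsP _ _ _ (jL \o l)) elt_v // dV.
Qed.
End Morphisms.
End Torsor.


Lemma galois_torsor k (x y : 'I_k -> M) : galois_family a sig x y ->
  exists V W, [/\ inAT a jM V, V *m W = 1%:M & twisted_fixed a jM sig id V].
Proof.
have sig_c g c : g \in unitset a -> sig g (jM c) = jM c by apply: sig_L.
have GV g : inG a g -> inG a (invmx g) by apply: inGV.
exact: (hilbert90 A1 AM GV sig_c sig1 sigM sig_L fixed_L).
Qed.

Lemma base_change : (exists k (x y : 'I_k -> M), galois_family a sig x y) ->
  exists phi : Kfield F m -> L,
    [/\ ringhom_on (inR a) phi, (forall c, phi (embF m c) = jF c) &
        exists psi : E -> M, is_base_change a iota S phi jL psi act sig].
Proof.
case=> k0 [x0 [y0 xy0]]; have [V [W [VA VW Vtw]]] := galois_torsor xy0.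
have [l lP] := torsor_base VA VW Vtw.
have [phi [phi_hom phi_poly phi_frac]] := exists_phi VW lP.
have [psi [psi_hom psi_poly psi_pol]] := exists_psi VA VW lP.
have [psiD psiM psi1] := psi_hom.
exists phi; split=> //; first by move=> c; rewrite phi_poly mmapC.
have psi_R r : inR a r -> psi (iota r) = jL (phi r).
  move=> Rr; have Sr := S_R Rr; case: Rr Sr => p [k ->]; set r' := _ / _ => Sr.
  have dl0 : jL (mmap jF l (dpoly a) ^+ k) * jL ((mmap jF l (dpoly a) ^+ k)^-1) = 1.
    by rewrite -rmorphM mulfV ?rmorph1 // expf_neq0 // (det_l_neq0 VW lP).
  have rE : iota r' * polE (dpoly a ^+ k) = polE p.
    rewrite /r' rmorphM fmorphV rmorphXn [in X in _ * X]rmorphXn mulfVK //.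
    by rewrite expf_neq0 // delta_neq0.
  have := congr1 psi rE; rewrite psiM //; last exact: S_pol.
  rewrite !psi_pol -(phi_frac p k) -/r' rmorphXn [in RHS]rmorphM.
  move/(congr1 ( *%R^~ (jL ((mmap jF l (dpoly a) ^+ k)^-1)))).
  by rewrite /= -!mulrA dl0 !mulr1.
have psi_act g s : inG a g -> S s -> psi (act g s) = sig g (psi s).
  move=> gG Ss; have [f [fE fK fU]] := actE gG; rewrite fE.
  have gU : g \in unitset a by apply/unitsetP.
  have fS z : S z -> S (f z) by rewrite -fE; apply: act_S.
  suff [] : S s /\ psi (f s) = sig g (psi s) by [].
  apply: (Ss (fun z => S z /\ psi (f z) = sig g (psi z))) => [|r Rr|i j].
  - have psiB z w : S z -> S w -> psi (z - w) = psi z - psi w.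
      by move=> Sz Sw; apply: (addIr (psi w)); rewrite -psiD ?subrK //; apply: SB.
    split=> [|z w [Sz IHz] [Sw IHw]|z w [Sz IHz] [Sw IHw]].
    + by split; [exact: S1 | rewrite rmorph1 psi1 rmorph1].
    + by split; [exact: SB | rewrite rmorphB !psiB ?rmorphB ?IHz ?IHw //; apply: fS].
    + by split; [exact: SM | rewrite rmorphM !psiM ?rmorphM ?IHz ?IHw //; apply: fS].
  - by split; [exact: S_R | rewrite fK psi_R // sig_L].
  - split; first exact: S_U.
    have -> : f (U i j) = mmap constE u ((Apoly a *m map_mx (@mpolyC m F) g) i j).
      transitivity (map_mx f U i j); first by rewrite mxE.
      rewrite fU -[mmap _ _ _]/(mmap constE u _).
      transitivity (map_mx (mmap constE u) (Apoly a *m map_mx (@mpolyC m F) g) i j).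
        case: U_sol => UA _ _; rewrite map_mxM map_Apoly elt_acoord // -map_mx_comp.
        by congr ((_ *m _) i j); apply: eq_map_mx => c /=; rewrite mmapC.
      by rewrite [LHS]mxE.
    rewrite psi_poly U_poly psi_poly.
    transitivity (map_mx (mmap jM (acoord jM ^~ V)) (Apoly a *m map_mx (@mpolyC m F) g) i j).
      by rewrite [RHS]mxE.
    rewrite map_mxM map_Apoly (elt_v VA) -map_mx_comp.
    transitivity ((V *m map_mx jM g) i j).
      by congr ((_ *m _) i j); apply: eq_map_mx => c /=; rewrite mmapC.
    rewrite -[map_mx jM g]/(map_mx jM (id g)) -Vtw // mxE; congr (sig g _).
    by rewrite -[in LHS](elt_v VA) -map_Apoly mxE.
exists psi; split=> // T alpha beta alpha_hom /ringhom_rmorphism[b ->] ab.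
have [alphaD alphaM alpha1] := alpha_hom.
(* The Galois coordinates of [M] served to find [V]; from here on those of [S] are used, since
   [alpha] is controlled only on [S]. *)
have [k [x [y [xyS xyE]]]] := galois_data.
have Sx i : S (x i) by case: (xyS i).
have Sy i : S (y i) by case: (xyS i).
have Sact g s : g \in unitset a -> S s -> S (act g s).
  by move=> /unitsetP gG; apply: act_S.
have psi_tr s : S s -> trG a sig (psi s) = psi (\sum_(g in unitset a) act g s).
  move=> Ss; rewrite (ringhom_on_S_sum _ psi_hom); last by move=> g gG; apply: Sact.
  by apply: eq_bigr => g /unitsetP gG; rewrite psi_act.
have GV g : inG a g -> inG a (invmx g) by apply: inGV.
have tr_R s : S s -> exists r, inR a r /\ \sum_(g in unitset a) act g s = iota r.
  move=> Ss; apply: S_fixed; first by apply: S_sum => g gG; apply: Sact.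
  move=> h hG; have hU : h \in unitset a by apply/unitsetP.
  have [f [fE _ _]] := actE hG; rewrite fE rmorph_sum /= -fE.
  rewrite -[RHS](unitset_reindex AM GV (fun g => act g s) hU).
  by apply: eq_bigr => g /unitsetP gG; rewrite act_mul.
have tr_L z : exists t, trG a sig z = jL t.
  by apply: fixed_L => g gG; apply: (trG_fixed AM GV sigM).
pose tau z := epsilon (inhabits 0) (fun t => trG a sig z = jL t).
have tauP z : trG a sig z = jL (tau z).
  exact: (epsilon_spec (inhabits 0) (fun t => trG a sig z = jL t) (tr_L z)).
have trGD z w : trG a sig (z + w) = trG a sig z + trG a sig w.
  by rewrite /trG -big_split; apply: eq_bigr => g _; rewrite rmorphD.
have trGZ t z : trG a sig (jL t * z) = jL t * trG a sig z.
  by rewrite /trG mulr_sumr; apply: eq_bigr => g gG; rewrite rmorphM sig_L.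
have tauD z w : tau (z + w) = tau z + tau w.
  by apply: jL_inj; rewrite rmorphD -!tauP trGD.
have tauZ t z : tau (jL t * z) = t * tau z.
  by apply: jL_inj; rewrite rmorphM -!tauP trGZ.
(* The images under [psi] are again Galois coordinates, and the traces of [M] lie in [L]. *)
have span z : z = \sum_i jL (tau (psi (y i) * z)) * psi (x i).
  transitivity (\sum_(g in unitset a) (g == 1%:M)%:R * sig g z).
    rewrite (bigD1 1%:M) ?unitset1 //= eqxx mul1r sig1 big1 ?addr0 //.
    by move=> g /andP[_ /negPf ->]; rewrite mul0r.
  rewrite (eq_bigr (fun g => \sum_i psi (x i) * sig g (psi (y i)) * sig g z)).
    rewrite exchange_big; apply: eq_bigr => i _ /=; rewrite -tauP mulrC mulr_sumr.
    by apply: eq_bigr => g _; rewrite rmorphM mulrA.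
  move=> g gG; rewrite -mulr_suml; congr (_ * _).
  transitivity (psi (\sum_i x i * act g (y i))).
    rewrite xyE; last exact/unitsetP.
    by case: eqP => _; rewrite ?psi1 // (ringhom_on_S0 psi_hom).
  rewrite (ringhom_on_S_sum _ psi_hom) => [|i _]; last by apply: SM => //; apply: Sact.
  by apply: eq_bigr => i _; rewrite psiM ?psi_act //; [apply/unitsetP | apply: Sact].
(* The expansion leaves no other choice: [b] on the coefficients and [alpha] on the [x i]. *)
pose gamma z := \sum_i b (tau (psi (y i) * z)) * alpha (x i).
have gammaD z w : gamma (z + w) = gamma z + gamma w.
  rewrite /gamma -big_split; apply: eq_bigr => i _ /=.
  by rewrite mulrDr tauD rmorphD mulrDl.
have gammaZ t z : gamma (jL t * z) = b t * gamma z.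
  rewrite /gamma mulr_sumr; apply: eq_bigr => i _.
  by rewrite mulrCA tauZ rmorphM mulrA.
(* For [s] in [S] the traces of [y i * s] lie in [R], where [alpha] and [b] agree through [phi]. *)
have gamma_psi s : S s -> gamma (psi s) = alpha s.
  move=> Ss; have /fin_all_exists[r rP] := fun i => tr_R (y i * s) (SM (Sy i) Ss).
  transitivity (alpha (\sum_i iota (r i) * x i)).
    rewrite (ringhom_on_S_sum _ alpha_hom) => [|i _]; last first.
      by apply: SM => //; apply: S_R; case: (rP i).
    apply: eq_bigr => i _; have [Rr rE] := rP i.
    rewrite alphaM //; last exact: S_R.
    rewrite ab //; congr (b _ * _); apply: jL_inj.
    by rewrite -tauP -psiM // psi_tr ?rE ?psi_R //; apply: SM.
  congr alpha; transitivity (\sum_(g in unitset a) (g == 1%:M)%:R * act g s).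
    rewrite (eq_bigr (fun i => \sum_(g in unitset a) x i * act g (y i) * act g s)).
      rewrite exchange_big; apply: eq_bigr => g gG /=; rewrite -mulr_suml xyE //.
        by case: (g == 1%:M).
      exact/unitsetP.
    move=> i _; have [_ <-] := rP i; rewrite mulrC mulr_sumr; apply: eq_bigr => g /unitsetP gG.
    by have [f [-> _ _]] := actE gG; rewrite rmorphM mulrA.
  rewrite (bigD1 1%:M) ?unitset1 //= eqxx mul1r act1 big1 ?addr0 //.
  by move=> g /andP[_ /negPf ->]; rewrite mul0r.
have gamma_sum (I : Type) (r : seq I) (G : I -> M) :
    gamma (\sum_(i <- r) G i) = \sum_(i <- r) gamma (G i).
  elim: r => [|i r IH]; last by rewrite !big_cons gammaD IH.
  by rewrite !big_nil -[X in gamma X](mul0r 1) -(rmorph0 jL) gammaZ rmorph0 mul0r.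
(* Multiplicativity comes in two stages: for a factor in [psi S], then for any factor by expanding
   it. *)
have gammaS s z : S s -> gamma (psi s * z) = alpha s * gamma z.
  move=> Ss; rewrite {1}[z]span mulr_sumr gamma_sum /gamma mulr_sumr; apply: eq_bigr => i _.
  by rewrite mulrCA -/(gamma _) gammaZ -psiM // gamma_psi ?alphaM //; [ring | apply: SM].
have gammaM z w : gamma (z * w) = gamma z * gamma w.
  rewrite {1}[z]span mulr_suml gamma_sum [gamma z]/gamma mulr_suml; apply: eq_bigr => i _.
  by rewrite -!mulrA gammaZ gammaS.
have gamma1 : gamma 1 = 1 by rewrite -psi1 gamma_psi //; exact: S1.
exists gamma; split=> // [t|gamma' /ringhom_rmorphism[g' ->] g'psi g'L z].
  by rewrite -[jL t]mulr1 gammaZ gamma1 mulr1.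
rewrite {1}[z]span rmorph_sum; apply: eq_bigr => i _ /=.
by rewrite rmorphM g'L g'psi.
Qed.
End BaseChange.

Lemma generic_ext : generic a iota S act.
Proof.
move=> L _ /ringhom_rmorphism[jF ->] M _ actM /ringhom_rmorphism[jL ->].
case=> _ actM_hom actM1 actMM [actM_fixed [k [x [y [_ xyE]]]]].
(* Nothing is known of [actM] outside the group; there [sig] is the identity, so that it consists of
   morphisms throughout. *)
have /fin_all_exists[sig sigE] : forall g : 'M[F]_n, exists f : {rmorphism M -> M},
    g \in unitset a -> actM g = f.
  move=> g; case: (boolP (g \in unitset a)) => [/unitsetP gG|_]; last by exists idfun.
  by have [_ /ringhom_rmorphism[f ->] _] := actM_hom g gG; exists f.
have sigL g l : g \in unitset a -> sig g (jL l) = jL l.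
  move=> gG; rewrite -sigE //; have [_ _ fixL] := actM_hom _ (elimT (unitsetP a g) gG).
  by apply: fixL; exists l.
have fixedL z : (forall g, g \in unitset a -> sig g z = z) -> exists l, z = jL l.
  move=> zfix; apply: actM_fixed => // g /unitsetP gG; rewrite sigE //; exact: zfix.
have sig1 z : sig 1%:M z = z by rewrite -sigE ?unitset1 // actM1.
have sigM g h z : g \in unitset a -> h \in unitset a -> sig (g *m h) z = sig g (sig h z).
  move=> gG hG; rewrite -!sigE ?unitsetM //; apply: actMM => //; exact/unitsetP.
have [|phi [phi_hom phiF [psi [psi_hom psi_R psi_act psi_univ]]]] :=
  base_change jF sigL fixedL sig1 sigM.
  exists k, x, y => g gG; rewrite -sigE // xyE; last exact/unitsetP.
  by case: (g == 1%:M).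
exists phi; split=> //; exists psi; split=> // g s gG Ss.
by rewrite psi_act // sigE //; apply/unitsetP.
Qed.

End Action.
End Solution.
End Lang.

Unset Implicit Arguments.

Theorem theorem3p2 (F : finFieldType) (n m : nat) (a : 'I_m -> 'M[F]_n)
  (E : fieldType) (iota : Kfield F m -> E) (U : 'M[E]_n) :
  is_basis_of_subalgebra a ->
  ringhom iota ->
  inGE a iota U ->
  entries_separable iota U ->
  map_mx iota (AK a) = U *m invmx (frobq F U) ->
  generated_by_U iota U ->
  (* (1) Gal(E/K) = A^x via sigma |-> U^{-1} sigma(U) *)
  [/\ (forall s, Kaut iota s -> exists g, inG a g /\ galmap iota U s g),
      (forall g, inG a g -> exists s, [/\ Kaut iota s, galmap iota U s g &
          forall s', Kaut iota s' -> galmap iota U s' g -> s' =1 s]) &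
      (forall s s' g h, Kaut iota s -> Kaut iota s' ->
          galmap iota U s g -> galmap iota U s' h -> galmap iota U (s \o s') (g *m h))]
  /\
  (* (2) S/R is a Galois G-extension which is G-generic over F_q *)
  (forall act : 'M[F]_n -> E -> E,
     (forall g, inG a g -> Kaut iota (act g) /\ galmap iota U (act g) g) ->
     GaloisExt a (inRE a iota) (inS a iota U) act /\
     generic a iota (inS a iota U) act).
Proof.
move=> [a_free A1 AM] /ringhom_rmorphism[f iotaE]; subst iota => -[UA Uu] _ AU Ugen.
have [kappa kappaP] := dual_basis a_free.
have Usol : is_solution a f U.
  split=> //; rewrite -map_AK AU mulmxKV //.
  by rewrite (frobq_map f) map_unitmx.
split; first split.
- exact: (gal_quotient kappaP A1 AM Usol).
- exact: (gal_exists kappaP A1 AM Usol Ugen).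
- by move=> s s' g h; apply: gal_comp.
move=> act actP; split.
- exact: (galois_ext kappaP A1 AM Usol Ugen actP).
- exact: (generic_ext kappaP A1 AM Usol Ugen actP).
Qed.
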